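(* Let $p\in(1,2)$ and $\kappa>0$. If the Markov generator $L$ satisfies $CD^{(p)}_\Upsilon(\kappa,\infty)$, $M_1\in\ell^2(\mu)$ and $M_2\in\ell^1(\mu)$, then $L$ satisfies the Beckner inequality $\mathrm{Bec}(\kappa)$, i.e. $$\mathcal{H}_p(f)\le\frac{1}{2\kappa}\,\mathcal{I}_p(f)$$ for every $f\in\mathcal{P}_*(X)$ with $\mathcal{H}_p(f)<\infty$.
   Context: Setting. $X$ is a finite or countably infinite set and $k:X\times X\to\mathbb{R}$ are transition rates of a continuous-time Markov chain $(Z_t)_{t\ge0}$ on $X$: $k(x,y)\ge 0$ for $x\neq y$ and $k(x,x)=-\sum_{y\neq x}k(x,y)<0$. The generator is $Lf(x)=\sum_{y\in X}k(x,y)(f(y)-f(x))$. Standing assumptions: the chain is irreducible (for all $x,y\in X$ there are $x=z_1,\dots,z_m=y$, $m\ge2$, with $k(z_i,z_{i+1})>0$); its invariant measure, unique up to positive multiples, can be normalized to a probability measure $\mu$ with density $\pi:X\to(0,\infty)$ with respect to counting measure; detailed balance $\pi(x)k(x,y)=\pi(y)k(y,x)$ holds; for every $x\in X$, $$M_1(x):=\sum_{y\neq x}k(x,y)<\infty,\qquad M_2(x):=\sum_{y\neq x}k(x,y)\sum_{z\neq y}k(y,z)<\infty;$$ and the semigroup $P_tf(x)=\mathbb{E}(f(Z_t)\mid Z_0=x)$ is Markov, i.e. $P_t1=1$ (the chain is non-explosive). Function classes. $\ell^p(\mu)$: $p$-summable functions with respect to $\mu$. $\ell^{\infty,+}(X)$: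 bounded $f:X\to\mathbb{R}$ with $\inf_Xf>0$. $\mathcal{P}_*(X)$: functions $f:X\to(0,\infty)$ with $\sum_xf(x)\pi(x)=1$. Power type entropy and Fisher information. For $p\in(1,2)$, $\Phi_p(r)=\frac{r^p-r}{p(p-1)}$ for $r\ge0$; $\mathcal{H}_p(\rho)=\sum_x\Phi_p(\rho(x))\pi(x)$ (value $\infty$ allowed); for $\rho\in\mathcal{P}_*(X)$, $$\mathcal{I}_p(\rho)=\tfrac12\sum_{x,y\in X}k(x,y)(\rho(y)-\rho(x))(\Phi_p'(\rho(y))-\Phi_p'(\rho(x)))\pi(x)\in[0,\infty].$$ Curvature condition. Let $\Upsilon(r)=e^r-1-r$ and $B_{\Upsilon'}(f,g)(x)=\sum_y k(x,y)\Upsilon'(f(y)-f(x))(g(y)-g(x))$. For a differentiable function $H$ put $\Lambda_H(w,z)=H(w)-H(z)-H'(z)(w-z)$. For $f\in\ell^{\infty,+}(X)$, $$\Psi^{(p)}_\Upsilon(f)(x)=-\sum_{y}k(x,y)\Lambda_{\Phi_p'}(f(y),f(x)),\qquad \Psi^{(p)}_{2,\Upsilon}(f)=\tfrac12\Big(L\Psi^{(p)}_\Upsilon(f)-B_{\Upsilon'}\big(\log f,L\Phi_p'(f)\big)\Big).$$ $L$ satisfies $CD_\Upsilon^{(p)}(\kappa,\infty)$ if $\Psi^{(p)}_{2,\Upsilon}(f)(x)\ge\frac{\kappa}{2-p}\Psi^{(p)}_\Upsilon(f)(x)$ for all $x\in X$ and all $f\in\ell^{\infty,+}(X)$. *)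

(* Defs.v *)
From HB Require Import structures.
From mathcomp Require Import all_boot all_order all_algebra.
From mathcomp Require Import all_classical all_reals all_analysis.
Set Implicit Arguments.
Unset Strict Implicit.
Unset Printing Implicit Defensive.
Import Order.TTheory GRing.Theory Num.Theory.
Import numFieldNormedType.Exports.
Local Open Scope classical_set_scope.
Local Open Scope ring_scope.

Section Sums.
Context {R : realType} {X : countType}.
Implicit Types (f dens : X -> R).

(* [esum] is meant for nonnegative families; a signed family is summed as the
   integral of its positive part minus that of its negative part with respect
   to the counting measure.  This is meaningful as soon as one of the two
   parts is finite. *)
Definition xsum f : \bar R :=
  (\esum_(x in [set: X]) (EFin \o f)^\+ x -
   \esum_(x in [set: X]) (EFin \o f)^\- x)%E.

(* Only relevant for absolutely summable families. *)
Definition rsum f : R := fine (xsum f).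

(* [in_lp dens q f]: f is in l^q(mu), where mu has density [dens] with respect
   to the counting measure. *)
Definition in_lp dens (q : R) f : Prop :=
  (\esum_(x in [set: X]) (`|f x| `^ q * dens x)%:E < +oo)%E.

Definition linfty_plus f : Prop := bounded_fun f /\ 0 < inf (range f).

Definition prob_density dens f : Prop :=
  (forall x, 0 < f x) /\ \esum_(x in [set: X]) (f x * dens x)%:E = 1%E.

End Sums.

Section Rates.
Context {R : realType} {X : countType}.
Variable k : X -> X -> R.

Definition M1 (x : X) : \bar R := \esum_(y in [set y | y != x]) (k x y)%:E.

Definition M2 (x : X) : \bar R :=
  \esum_(y in [set y | y != x]) ((k x y)%:E * M1 y)%E.

Definition transition_rates : Prop :=
  (forall x y, x != y -> 0 <= k x y) /\
  (forall x, M1 x = (- k x x)%:E /\ k x x < 0).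

Definition irreducible : Prop :=
  forall x y, exists s : seq X,
    [/\ s != [::], path (fun u v => 0 < k u v) x s & last x s = y].

Definition detailed_balance (dens : X -> R) : Prop :=
  forall x y, dens x * k x y = dens y * k y x.

Definition generator (f : X -> R) (x : X) : R :=
  rsum (fun y => k x y * (f y - f x)).

End Rates.

(* The continuous-time Markov chain with rates k is given by its jump chain
   [Y n] and its successive holding times [T n], on a measurable space [Omega]
   carrying the laws [Pr x] of the chain started at x (that is, [Pr x] plays
   the role of the conditional probability given Z_0 = x). *)
Section Chain.
Context {R : realType} {X : countType} {d : measure_display}
  {Omega : measurableType d}.
Variables (k : X -> X -> R) (Pr : X -> probability Omega R)
  (Y : nat -> Omega -> X) (T : nat -> Omega -> R).

Definition jump_prob (x y : X) : R :=
  if x == y then 0 else k x y / (- k x x).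

(* Under [Pr x], Y is a Markov chain started at x with transition matrix
   [jump_prob] and, given Y, the holding times T i are independent and
   exponential with parameters - k (Y i) (Y i). *)
Definition markov_chain : Prop :=
  [/\ (forall n y, measurable (Y n @^-1` [set y])),
      (forall n, measurable_fun [set: Omega] (T n)),
      (forall n w, 0 < T n w) &
      forall (x : X) (n : nat) (ys : nat -> X) (ts : nat -> R),
        (forall i, 0 <= ts i) ->
        Pr x ([set w | forall i, (i <= n)%N -> Y i w = ys i] `&`
              [set w | forall i, (i < n)%N -> ts i < T i w]) =
        ((x == ys 0%N)%:R *
         \prod_(i < n) (jump_prob (ys i) (ys i.+1) *
                        expR (k (ys i) (ys i) * ts i)))%:E].

Definition jump_time (n : nat) (w : Omega) : R := \sum_(i < n) T i w.

(* The position Z_t; [None] means that the chain has exploded by time t. *)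
Definition state (t : R) (w : Omega) : option X :=
  xget None [set Some (Y n w) |
    n in [set n | jump_time n w <= t < jump_time n.+1 w]].

(* P_t f(x) = E(f(Z_t) | Z_0 = x), with f extended by 0 after explosion. *)
Definition semigroup (t : R) (f : X -> R) (x : X) : \bar R :=
  (\int[Pr x]_w (oapp f 0 (state t w))%:E)%E.

Definition markovian : Prop :=
  forall t x, 0 <= t -> semigroup t (fun=> 1) x = 1%E.

Definition invariant_measure (nu : X -> R) : Prop :=
  [/\ (forall x, 0 <= nu x),
      (exists x, 0 < nu x) &
      forall t y, 0 <= t ->
        \esum_(x in [set: X])
          ((nu x)%:E * semigroup t (fun z => (z == y)%:R) x)%E = (nu y)%:E].

End Chain.

Section Entropy.
Context {R : realType} {X : countType}.
Variables (k : X -> X -> R) (dens : X -> R) (p : R).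

(* Used for r >= 0 only. *)
Definition Phi (r : R) : R := (r `^ p - r) / (p * (p - 1)).

Definition entropy (f : X -> R) : \bar R := xsum (fun x => Phi (f x) * dens x).

Definition fisher (f : X -> R) : \bar R :=
  ((2^-1)%:E * \esum_(z in [set: X * X])
    (k z.1 z.2 * (f z.2 - f z.1) *
     (derive1 Phi (f z.2) - derive1 Phi (f z.1)) * dens z.1)%:E)%E.

Definition Beckner (kappa : R) : Prop :=
  forall f, prob_density dens f -> (entropy f < +oo)%E ->
    (entropy f <= (1 / (2 * kappa))%:E * fisher f)%E.

End Entropy.

Section Curvature.
Context {R : realType} {X : countType}.
Variables (k : X -> X -> R) (p : R).

Definition Upsilon (r : R) : R := expR r - 1 - r.

Definition Bform (H : R -> R) (f g : X -> R) (x : X) : R :=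
  rsum (fun y => k x y * H (f y - f x) * (g y - g x)).

Definition Lambda (H : R -> R) (w z : R) : R := 
  H w - H z - derive1 H z * (w - z).

Definition Psi (f : X -> R) (x : X) : R :=
  - rsum (fun y => k x y * Lambda (derive1 (Phi p)) (f y) (f x)).

Definition Psi2 (f : X -> R) (x : X) : R :=
  2^-1 * (generator k (Psi f) x -
          Bform (derive1 Upsilon) (@ln R \o f)
            (generator k (derive1 (Phi p) \o f)) x).

Definition CD_Upsilon (kappa : R) : Prop :=
  forall (f : X -> R) (x : X), linfty_plus f ->
    kappa / (2 - p) * Psi f x <= Psi2 f x.

End Curvature.

(* Main.v *)
(** Write phi = Phi_p' and let I be the Fisher information, H the entropy, E the
    Dirichlet energy.  The Markov semigroup is replaced by implicit Euler steps
    f = g - h L g: for f with values in [m, M], 0 < m, the solution g has values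
    in [m, M], and all sums below converge absolutely because M_1 is in l^2(mu).

    The function (s, t) |-> (s - t)(phi s - phi t) is jointly convex, so I f is at
    least its first-order expansion at g in the direction f - g = - h L g; summing
    CD against g dens shows that the linear term is at least 2 kappa h I g.  Thus
    (1 + 2 kappa h) I g <= I f, without any differentiation in time.  A Taylor
    bound gives H f <= H g + h I g + C h^2 |L g|^2, and convexity of E gives
    E f >= E g + 2 h |L g|^2.  Hence H - I / (2 kappa) - (C h / 2) E does not
    decrease along the scheme.  Iterating with h fixed, I tends to 0, so by
    irreducibility the iterates converge to their common mean c and H to Phi c;
    then h -> 0 gives H f <= Phi c + I f / (2 kappa).

    For a general density f this is applied to max(m, min(f, M)), whose Fisher
    information is at most I f and whose mean is at most 1 + m. *)

Require Import Defs.
From HB Require Import structures.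
From mathcomp Require Import all_boot all_order all_algebra.
From mathcomp Require Import all_classical all_reals all_analysis.
From mathcomp Require Import ring lra.
Import Order.TTheory GRing.Theory Num.Theory.
Import numFieldNormedType.Exports.
Local Open Scope classical_set_scope.
Local Open Scope ring_scope.

Set Implicit Arguments.
Unset Strict Implicit.
Unset Printing Implicit Defensive.

(** * Absolutely convergent sums *)

Section AbsolutelySummable.
Context {R : realType} {T : countType}.
Implicit Types f g : T -> R.

Definition abs_summable f := summable [set: T] (EFin \o f).

Lemma abs_summable_le g f :
  (forall x, `|f x| <= g x) -> abs_summable g -> abs_summable f.
Proof.
move=> fg; apply: le_lt_trans; apply: le_esum => x _ /=.
by rewrite lee_fin (le_trans (fg x))// ler_norm.
Qed.

Lemma eq_abs_summable f g : f =1 g -> abs_summable f -> abs_summable g.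
Proof. by move=> /funext ->. Qed.

Lemma ge0_abs_summable f : (forall x, 0 <= f x) ->
  (\esum_(x in [set: T]) (f x)%:E < +oo)%E -> abs_summable f.
Proof.
move=> f0; apply: le_lt_trans; apply: le_esum => x _ /=.
by rewrite ger0_norm.
Qed.

Lemma abs_summableD f g :
  abs_summable f -> abs_summable g -> abs_summable (fun x => f x + g x).
Proof. by move=> sf sg; apply: summableD sf sg. Qed.

Lemma abs_summableN f : abs_summable f -> abs_summable (fun x => - f x).
Proof. by move=> sf; rewrite /abs_summable -/(summable _ _) summableN in sf *. Qed.

Lemma abs_summable_norm f :
  abs_summable f -> abs_summable (fun x => `|f x|).
Proof.
by apply: le_lt_trans; apply: le_esum => x _ /=; rewrite normr_id.
Qed.

Lemma ge0_esumZ (c : R) f : 0 <= c -> (forall x, 0 <= f x) ->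
  (\esum_(x in [set: T]) (c * f x)%:E =
   c%:E * \esum_(x in [set: T]) (f x)%:E)%E.
Proof.
move=> c0 f0; rewrite /esum -ereal_supZl//; last first.
  by apply/set0P; exists (\sum_(x \in set0) (f x)%:E)%E, set0 => //; exact: fsets_set0.
congr ereal_sup; rewrite image_comp; apply: eq_imagel => A _ /=.
by rewrite ge0_mule_fsumr.
Qed.

Lemma abs_summableZ c f : abs_summable f -> abs_summable (fun x => c * f x).
Proof.
move=> sf; apply: (@abs_summable_le (fun x => `|c| * `|f x|)).
  by move=> x; rewrite normrM.
apply: ge0_abs_summable => [x|]; first exact: mulr_ge0.
by rewrite ge0_esumZ// lte_mul_pinfty// lee_fin.
Qed.

Lemma abs_summableB f g :
  abs_summable f -> abs_summable g -> abs_summable (fun x => f x - g x).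
Proof. by move=> sf sg; exact/abs_summableD/abs_summableN. Qed.

Lemma rsumE f : (forall x, 0 <= f x) ->
  rsum f = fine (\esum_(x in [set: T]) (f x)%:E).
Proof.
move=> f0; rewrite /rsum /xsum.
rewrite [X in (_ - X)%E]esum1 ?sube0//.
  congr fine; apply: eq_esum => x _.
  by rewrite funeposE /= max_l// lee_fin.
by move=> x _; rewrite funenegE /= max_r// lee_fin oppr_le0.
Qed.

Lemma EFin_rsum f : (forall x, 0 <= f x) -> abs_summable f ->
  (rsum f)%:E = (\esum_(x in [set: T]) (f x)%:E)%E.
Proof.
move=> f0 sf; rewrite rsumE// fineK// ge0_fin_numE ?esum_ge0//.
  move: sf; apply: le_lt_trans; apply: le_esum => x _ /=.
  by rewrite lee_fin ler_norm.
by move=> x _; rewrite lee_fin.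
Qed.

Lemma eq_rsum f g : f =1 g -> rsum f = rsum g.
Proof. by move=> /funext ->. Qed.

Lemma rsum_ge0 f : (forall x, 0 <= f x) -> 0 <= rsum f.
Proof.
by move=> f0; rewrite rsumE// fine_ge0// esum_ge0// => x _; rewrite lee_fin.
Qed.

Lemma rsum0 : rsum (fun _ : T => 0 : R) = 0.
Proof. by rewrite rsumE// esum1. Qed.

(** Any splitting into nonnegative summable families computes the signed sum, not only the one into
    positive and negative parts. Linearity of [rsum] rests on this. *)
Lemma xsumB_ge0 f g : (forall x, 0 <= f x) -> (forall x, 0 <= g x) ->
  abs_summable f -> abs_summable g ->
  xsum (fun x => f x - g x) = (rsum f - rsum g)%:E.
Proof.
move=> f0 g0 sf sg; rewrite EFinB !EFin_rsum// -esumB//.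
- by move=> x _; rewrite lee_fin.
- by move=> x _; rewrite lee_fin.
Qed.

Lemma rsumB_ge0 f g : (forall x, 0 <= f x) -> (forall x, 0 <= g x) ->
  abs_summable f -> abs_summable g ->
  rsum (fun x => f x - g x) = rsum f - rsum g.
Proof. by move=> f0 g0 sf sg; rewrite {1}/rsum xsumB_ge0. Qed.

Lemma rsumD_ge0 f g : (forall x, 0 <= f x) -> (forall x, 0 <= g x) ->
  abs_summable f -> abs_summable g ->
  rsum (fun x => f x + g x) = rsum f + rsum g.
Proof.
move=> f0 g0 sf sg; apply: EFin_inj; rewrite EFinD !EFin_rsum//.
- by rewrite -esumD// => x _; rewrite lee_fin.
- by move=> x; rewrite addr_ge0.
- exact: abs_summableD.
Qed.

Definition rpos f x := Num.max (f x) 0.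
Definition rneg f x := Num.max (- f x) 0.

Lemma rpos_ge0 f x : 0 <= rpos f x. Proof. by rewrite le_max lexx orbT. Qed.
Lemma rneg_ge0 f x : 0 <= rneg f x. Proof. by rewrite le_max lexx orbT. Qed.

Lemma rposBneg f x : f x = rpos f x - rneg f x.
Proof. by rewrite /rpos /rneg; case: (lerP (f x) 0) => ?; case: lerP => ?; lra. Qed.

Lemma rpos_le f x : rpos f x <= `|f x|.
Proof. by rewrite ge_max ler_norm normr_ge0. Qed.

Lemma rneg_le f x : rneg f x <= `|f x|.
Proof. by rewrite ge_max -normrN ler_norm normr_ge0. Qed.

Lemma abs_summable_pos f : abs_summable f -> abs_summable (rpos f).
Proof.
move=> /abs_summable_norm; apply: abs_summable_le => x.
by rewrite ger0_norm ?rpos_le ?rpos_ge0.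
Qed.

Lemma abs_summable_neg f : abs_summable f -> abs_summable (rneg f).
Proof.
move=> /abs_summable_norm; apply: abs_summable_le => x.
by rewrite ger0_norm ?rneg_le ?rneg_ge0.
Qed.

Lemma xsum_rsum f : abs_summable f -> xsum f = (rsum f)%:E.
Proof.
move=> sf; rewrite /rsum (funext (rposBneg f)) xsumB_ge0//.
- exact: rpos_ge0.
- exact: rneg_ge0.
- exact: abs_summable_pos.
- exact: abs_summable_neg.
Qed.

Lemma rsum_posneg f : abs_summable f -> rsum f = rsum (rpos f) - rsum (rneg f).
Proof.
move=> sf; rewrite {1}(funext (rposBneg f)) rsumB_ge0//.
- exact: rpos_ge0.
- exact: rneg_ge0.
- exact: abs_summable_pos.
- exact: abs_summable_neg.
Qed.

Lemma rsumD f g : abs_summable f -> abs_summable g ->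
  rsum (fun x => f x + g x) = rsum f + rsum g.
Proof.
move=> sf sg; rewrite (rsum_posneg sf) (rsum_posneg sg).
have [sfp sfn] := (abs_summable_pos sf, abs_summable_neg sf).
have [sgp sgn] := (abs_summable_pos sg, abs_summable_neg sg).
have [fp fn gp gn] := And4 (rpos_ge0 f) (rneg_ge0 f) (rpos_ge0 g) (rneg_ge0 g).
rewrite addrACA -opprD -!rsumD_ge0// -rsumB_ge0//.
- by apply: eq_rsum => x; rewrite {1}rposBneg {1}(rposBneg g); ring.
- by move=> x; rewrite addr_ge0.
- by move=> x; rewrite addr_ge0.
- exact: abs_summableD.
- exact: abs_summableD.
Qed.

Lemma rsumN f : abs_summable f -> rsum (fun x => - f x) = - rsum f.
Proof.
move=> sf; apply/eqP; rewrite -addr_eq0 -rsumD//; last exact: abs_summableN.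
by rewrite -[X in _ == X]rsum0; apply/eqP/eq_rsum => x; rewrite addNr.
Qed.

Lemma rsumB f g : abs_summable f -> abs_summable g ->
  rsum (fun x => f x - g x) = rsum f - rsum g.
Proof. by move=> sf sg; rewrite rsumD ?rsumN//; exact: abs_summableN. Qed.

Lemma rsumZ c f : abs_summable f -> rsum (fun x => c * f x) = c * rsum f.
Proof.
move=> sf; have [sfp sfn] := (abs_summable_pos sf, abs_summable_neg sf).
have Zge0 b g : (forall x, 0 <= g x) -> abs_summable g -> 0 <= b ->
    rsum (fun x => b * g x) = b * rsum g.
  move=> g0 sg b0; apply: EFin_inj; rewrite EFinM !EFin_rsum//.
  - exact: ge0_esumZ.
  - by move=> x; rewrite mulr_ge0.
  - exact: abs_summableZ.
have Z b : 0 <= b -> rsum (fun x => b * f x) = b * rsum f.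
  move=> b0; rewrite (rsum_posneg sf) mulrBr -!Zge0//; last 2 first.
  - exact: rneg_ge0.
  - exact: rpos_ge0.
  rewrite -rsumB; [|exact: abs_summableZ..].
  by apply: eq_rsum => x; rewrite -mulrBr -rposBneg.
have [c0|c0] := leP 0 c; first exact: Z.
rewrite -[LHS]opprK -rsumN; last exact: abs_summableZ.
have : 0 <= - c by lra.
move=> /Z; rewrite mulNr => /(congr1 -%R); rewrite opprK => <-.
by congr (- _); apply: eq_rsum => x; rewrite mulNr.
Qed.

Lemma ler_rsum f g : abs_summable f -> abs_summable g ->
  (forall x, f x <= g x) -> rsum f <= rsum g.
Proof.
move=> sf sg fg; rewrite -subr_ge0 -rsumB//; apply: rsum_ge0 => x.
by rewrite subr_ge0.
Qed.

Lemma rsum_ge_term f x : (forall x, 0 <= f x) -> abs_summable f ->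
  f x <= rsum f.
Proof.
move=> f0 sf; rewrite -lee_fin EFin_rsum//; apply: esum_ge.
by exists [set x]; [split|rewrite fsbig_set1].
Qed.

Lemma rsum_norm f : abs_summable f -> `|rsum f| <= rsum (fun x => `|f x|).
Proof.
move=> sf; rewrite ler_norml; have sn := abs_summable_norm sf.
rewrite -rsumN//; apply/andP; split; apply: ler_rsum => //.
- exact: abs_summableN.
- by move=> x; rewrite lerNl -normrN ler_norm.
- by move=> x; rewrite ler_norm.
Qed.

End AbsolutelySummable.

(** * Tonelli and Fubini theorems for double families *)

Section IteratedSums.
Context {R : realType} {T1 T2 : countType}.
Implicit Types F : T1 * T2 -> R.

Lemma esum_pair (F : T1 * T2 -> \bar R) : (forall z, 0 <= F z)%E ->
  (\esum_(x in [set: T1]) \esum_(y in [set: T2]) F (x, y) =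
   \esum_(z in [set: T1 * T2]) F z)%E.
Proof.
move=> F0; rewrite (@esum_esum _ _ _ _ (fun=> setT) (fun x y => F (x, y)))//.
have -> : [set: T1] `*`` (fun=> [set: T2]) = [set: T1 * T2].
  by apply/seteqP; split.
by apply: eq_esum => -[].
Qed.

Lemma abs_summable_row F x :
  abs_summable F -> abs_summable (fun y => F (x, y)).
Proof.
move=> sF; apply: le_lt_trans sF; rewrite -esum_pair//.
apply: esum_ge; exists [set x]; first by split.
by rewrite fsbig_set1.
Qed.

Lemma rsum_pair_ge0 F : (forall z, 0 <= F z) -> abs_summable F ->
  abs_summable (fun x => rsum (fun y => F (x, y))) /\
  rsum F = rsum (fun x => rsum (fun y => F (x, y))).
Proof.
move=> F0 sF.
have r0 x : 0 <= rsum (fun y => F (x, y)) by exact: rsum_ge0.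
have E : (\esum_(x in [set: T1]) (rsum (fun y => F (x, y)))%:E =
    (rsum F)%:E)%E.
  rewrite EFin_rsum// -esum_pair; last by move=> z; rewrite lee_fin.
  by apply: eq_esum => x _; rewrite EFin_rsum//; exact: abs_summable_row.
have s : abs_summable (fun x => rsum (fun y => F (x, y))).
  by apply: ge0_abs_summable => //; rewrite E ltry.
by split => //; apply: EFin_inj; rewrite -E EFin_rsum.
Qed.

Lemma abs_summable_row_sum F : abs_summable F ->
  abs_summable (fun x => rsum (fun y => F (x, y))).
Proof.
move=> sF; have sn := abs_summable_norm sF.
have [+ _] := rsum_pair_ge0 (fun z => normr_ge0 _) sn.
apply: abs_summable_le => x; apply: rsum_norm; exact: abs_summable_row.
Qed.

Lemma rsum_pair F : abs_summable F ->
  rsum F = rsum (fun x => rsum (fun y => F (x, y))).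
Proof.
move=> sF; have [sp sn] := (abs_summable_pos sF, abs_summable_neg sF).
have [sp1 Ep] := rsum_pair_ge0 (rpos_ge0 F) sp.
have [sn1 En] := rsum_pair_ge0 (rneg_ge0 F) sn.
rewrite rsum_posneg// Ep En -rsumB//; apply: eq_rsum => x.
rewrite -rsumB; [|exact: abs_summable_row..].
by apply: eq_rsum => y; rewrite -rposBneg.
Qed.

Lemma abs_summable_pair F : (forall z, 0 <= F z) ->
  (forall x, abs_summable (fun y => F (x, y))) ->
  abs_summable (fun x => rsum (fun y => F (x, y))) ->
  abs_summable F.
Proof.
move=> F0 sr s; apply: ge0_abs_summable => //.
rewrite -(@esum_pair (EFin \o F))/=; last by move=> z; rewrite lee_fin.
rewrite (eq_esum (b := fun x => (rsum (fun y => F (x, y)))%:E)); last first.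
  by move=> x _; rewrite EFin_rsum.
rewrite -EFin_rsum ?ltry// => x; exact: rsum_ge0.
Qed.

End IteratedSums.

Section SwappedSums.
Context {R : realType} {T : countType}.
Implicit Types F : T * T -> R.

Let swap (z : T * T) := (z.2, z.1).

Let esum_swap (F : T * T -> \bar R) :
  (\esum_(z in [set: T * T]) F (z.2, z.1) = \esum_(z in [set: T * T]) F z)%E.
Proof.
rewrite [RHS](@reindex_esum _ _ _ [set: T * T] [set: T * T] swap)//.
split=> //; first by move=> [a b] [c e] _ _ [-> ->].
by move=> [a b] _; exists (b, a).
Qed.

Lemma abs_summable_swap F :
  abs_summable F -> abs_summable (fun z => F (z.2, z.1)).
Proof. by rewrite /abs_summable /summable -esum_swap. Qed.

Lemma rsum_swap F : rsum (fun z => F (z.2, z.1)) = rsum F.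
Proof.
rewrite /rsum /xsum -[in RHS]esum_swap -[in RHS](esum_swap (EFin \o F)^\-%E).
congr (fine (_ - _)%E); apply: eq_esum => z _.
  by rewrite !funeposE.
by rewrite !funenegE.
Qed.

End SwappedSums.

(** * Tails of weighted sums and bounded convergence *)

Section BoundedConvergence.
Context {R : realType} {T : countType}.

Lemma rsum_restrict (w : T -> R) (e : R) : (forall x, 0 <= w x) ->
  abs_summable w -> 0 < e ->
  exists s : seq T, rsum (fun x => (x \notin s)%:R * w x) < e.
Proof.
move=> w0 sw e0.
have : ((rsum w - e)%:E < \esum_(x in [set: T]) (w x)%:E)%E.
  by rewrite -EFin_rsum// lte_fin ltrBlDr ltrDl.
move=> /ereal_sup_gt[_ [A [finA _] <-] ltA].
have [s As] := (finite_seqP A).1 finA; exists s.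
have sin : abs_summable (fun x => (x \in s)%:R * w x).
  apply: abs_summable_le sw => x.
  by case: (x \in s); rewrite ?mul1r ?mul0r ?normr0// ger0_norm.
have -> : rsum (fun x => (x \notin s)%:R * w x) =
    rsum w - rsum (fun x => (x \in s)%:R * w x).
  rewrite -rsumB//; apply: eq_rsum => x.
  by case: (x \in s); rewrite ?mul1r ?mul0r ?subrr ?subr0.
rewrite ltrBlDr -ltrBlDl -lte_fin; apply: lt_le_trans ltA _.
rewrite EFin_rsum//; last by move=> x; rewrite mulr_ge0.
apply: esum_ge; exists A => //; rewrite le_eqVlt; apply/orP; left; apply/eqP.
by apply: eq_fsbigr => x; rewrite As inE /= => ->; rewrite mul1r.
Qed.

(** All but a small part of the weight sits on a finite set, where pointwise convergence is uniform;
    elsewhere the bound [B] suffices. *)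
Lemma rsum_bounded_cvg0 (w : T -> R) (v : nat -> T -> R) (B : R) :
  (forall x, 0 <= w x) -> abs_summable w ->
  (forall n x, 0 <= v n x <= B) ->
  (forall x (e : R), 0 < e -> exists N, forall n, (N <= n)%N -> v n x <= e) ->
  forall e : R, 0 < e -> exists n, rsum (fun x => w x * v n x) <= e.
Proof.
move=> w0 sw vB v0 e e0; set S := rsum w.
have S0 : 0 <= S by exact: rsum_ge0.
(* [B1], and [S + 1] below, are positive divisors replacing [B] and [S], which may be zero. *)
pose B1 : R := `|B| + 1; have B1gt : 0 < B1 by rewrite ltr_wpDl.
have d0 : 0 < e / (2 * B1) by rewrite divr_gt0// mulr_gt0.
have [s hs] := rsum_restrict w0 sw d0.
have e1 : 0 < e / (2 * (S + 1)) by rewrite divr_gt0// mulr_gt0// ltr_wpDl.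
have [N hN] : exists N, forall n, (N <= n)%N -> forall x, x \in s ->
    v n x <= e / (2 * (S + 1)).
  elim: s {hs} => [|x s [N hN]]; first by exists 0%N.
  have [M hM] := v0 x _ e1; exists (maxn N M) => n; rewrite geq_max => /andP[Nn Mn] y.
  by rewrite inE => /predU1P[->|]; [exact: hM|exact: hN].
exists N.
have so : abs_summable (fun x => (x \notin s)%:R * w x).
  apply: abs_summable_le sw => x.
  by case: (x \in s); rewrite ?mul1r ?mul0r ?normr0// ger0_norm.
have le x : w x * v N x <= e / (2 * (S + 1)) * w x + B1 * ((x \notin s)%:R * w x).
  have /andP[v1 v2] := vB N x; have [xs|xs] := boolP (x \in s).
    by rewrite mul0r mulr0 addr0 mulrC ler_wpM2r// hN.
  rewrite /= mul1r mulrC -[leLHS]add0r lerD//.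
    by rewrite mulr_ge0// ltW.
  by rewrite ler_wpM2r// (le_trans v2)// /B1 (le_trans (ler_norm B))// lerDl.
apply: (@le_trans _ _ (e / (2 * (S + 1)) * S + B1 * (e / (2 * B1)))).
  rewrite (le_trans (ler_rsum _ _ le))//.
  - apply: abs_summable_le (abs_summableZ B sw) => x.
    have /andP[v1 v2] := vB N x.
    by rewrite ger0_norm ?mulr_ge0// mulrC ler_wpM2r.
  - by apply: abs_summableD; exact: abs_summableZ.
  rewrite rsumD; [|exact: abs_summableZ..].
  by rewrite !rsumZ// lerD2l ler_wpM2l ?ltW.
have -> : B1 * (e / (2 * B1)) = e / 2 by field; rewrite gt_eqF.
have -> : e / (2 * (S + 1)) * S = e / 2 * (S / (S + 1)).
  by field; rewrite gt_eqF// ltr_wpDl.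
have : S / (S + 1) <= 1 by rewrite ler_pdivrMr ?mul1r ?lerDl// ltr_wpDl.
move=> /(ler_wpM2l (ltW (divr_gt0 e0 (ltr0Sn R 1)))); lra.
Qed.

End BoundedConvergence.

(** * Convexity inequalities for powers *)

Section PowerInequalities.
Context {R : realType}.
Implicit Types r s t u v al q : R.

Lemma gt0_powRD s a b : 0 < s -> s `^ (a + b) = s `^ a * s `^ b.
Proof. by move=> s0; rewrite powRD// (gt_eqF s0) implybT. Qed.

(** Young's inequality for r^al and s^(1-al) with conjugate exponents 1/al and 1/(1-al). *)
Lemma powR_weighted_amgm r s al : 0 <= r -> 0 <= s -> 0 < al < 1 ->
  r `^ al * s `^ (1 - al) <= al * r + (1 - al) * s.
Proof.
move=> r0 s0 /andP[al0 al1]; have al1' : 0 < 1 - al by rewrite subr_gt0.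
have := @conjugate_powR R (r `^ al) (s `^ (1 - al)) al^-1 (1 - al)^-1
  (powR_ge0 _ _) (powR_ge0 _ _).
rewrite !invrK !invr_gt0 -!powRrM !mulfV ?gt_eqF// !powRr1// => /(_ al0 al1').
rewrite addrC subrK (mulrC al) (mulrC (1 - al)); exact.
Qed.

(** The weighted mean inequality multiplied by s^(al-1). *)
Lemma powR_tangent_concave r s al : 0 < r -> 0 < s -> 0 < al < 1 ->
  r `^ al <= s `^ al + al * s `^ (al - 1) * (r - s).
Proof.
move=> r0 s0 al01.
have := powR_weighted_amgm (ltW r0) (ltW s0) al01.
move=> /(ler_wpM2r (powR_ge0 s (al - 1))) /=.
rewrite -(mulrA (r `^ al)) -gt0_powRD//.
rewrite (_ : 1 - al + (al - 1) = 0); last by ring.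
rewrite powRr0 mulr1 => /le_trans; apply.
have -> : s `^ al = s * s `^ (al - 1).
  by rewrite mulr_powRB1 ?ltW//; case/andP: al01.
rewrite le_eqVlt; apply/orP; left; apply/eqP; ring.
Qed.

(** The weighted mean inequality for r^q and s^q with weight 1/q. *)
Lemma powR_tangent_convex r s q : 0 < r -> 0 < s -> 1 < q ->
  s `^ q + q * s `^ (q - 1) * (r - s) <= r `^ q.
Proof.
move=> r0 s0 q1; have q0 : 0 < q by lra.
have qi : 0 < q^-1 < 1 by rewrite invr_gt0 q0 invf_lt1.
have := powR_weighted_amgm (powR_ge0 r q) (powR_ge0 s q) qi.
rewrite -!powRrM mulfV ?gt_eqF// powRr1; last exact: ltW.
rewrite mulrBr mulr1 mulfV ?gt_eqF// => /(ler_wpM2l (ltW q0)) /=.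
have -> : q * (q^-1 * r `^ q + (1 - q^-1) * s `^ q) =
    r `^ q + (q - 1) * s `^ q by field; rewrite gt_eqF.
have -> : s `^ q = s * s `^ (q - 1) by rewrite mulr_powRB1 ?ltW.
by nra.
Qed.

Lemma is_derive_affine (a b x : R) : is_derive x 1 (fun y => b + y * a) a.
Proof.
have := is_deriveD (is_derive_cst b x 1) (is_deriveZ a (is_derive_id x 1)).
rewrite add0r /GRing.scale /= mulr1.
have -> : cst b + a *: id = (fun y => b + y * a); last by [].
by apply/funext => y /=; rewrite mulrC.
Qed.

Lemma is_derive_powR_affine (a b q x : R) : 0 < b + x * a ->
  is_derive x 1 (fun y => (b + y * a) `^ q) (q * (b + x * a) `^ (q - 1) * a).
Proof.
move=> pos; apply: (@is_derive1_comp _ (fun y => y `^ q) (fun y => b + y * a)).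
  exact: is_derive1_powR.
exact: is_derive_affine.
Qed.

(* The square completed here is (z - zt c / c0)^2 / c with c = r^(1-q) and
   c0 = rh^(1-q). *)
Lemma perspective_derivative_ge0 (z zt r rh q : R) :
  0 < r -> 0 < rh -> 0 < q < 1 ->
  0 <= r `^ (q - 1) * z ^+ 2 - 2 * rh `^ (q - 1) * zt * z +
       rh `^ (q - 1) * zt ^+ 2 + (1 - q) * rh `^ (q - 1 - 1) * zt ^+ 2 * (r - rh).
Proof.
move=> r0 rh0 q01; have al01 : 0 < 1 - q < 1 by lra.
have T := powR_tangent_concave r0 rh0 al01.
set a := r `^ (q - 1); set b := rh `^ (q - 1).
have a0 : 0 < a by exact: powR_gt0.
have b0 : 0 < b by exact: powR_gt0.
have inva x : x `^ (1 - q) = (x `^ (q - 1))^-1.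
  by rewrite -powRN opprB.
have e2 : rh `^ (1 - q - 1) * b ^+ 2 = rh `^ (q - 1 - 1).
  rewrite /b expr2 -!gt0_powRD//; congr (powR _ _); ring.
rewrite -e2; move: T; rewrite !inva -/a -/b => T.
(* Concavity of r^(1-q), multiplied by b^2, bounds the constant term of the completed square by the
   terms of the claim that are affine in r. *)
have {}T : a^-1 * b ^+ 2 <= b + (1 - q) * rh `^ (1 - q - 1) * b ^+ 2 * (r - rh).
  have := ler_wpM2r (ltW (exprn_gt0 2 b0)) T.
  have -> : (b^-1 + (1 - q) * rh `^ (1 - q - 1) * (r - rh)) * b ^+ 2 =
    b + (1 - q) * rh `^ (1 - q - 1) * b ^+ 2 * (r - rh) by field; rewrite gt_eqF.
  by [].
have : 0 <= a * (z - zt * b * a^-1) ^+ 2 by rewrite mulr_ge0 ?sqr_ge0// ltW.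
have -> : a * (z - zt * b * a^-1) ^+ 2 =
  a * z ^+ 2 - 2 * b * zt * z + zt ^+ 2 * (a^-1 * b ^+ 2) by field; rewrite gt_eqF.
have := ler_wpM2l (sqr_ge0 zt) T; lra.
Qed.

(* Joint convexity of (s, t) |-> (s - t)(s^q - t^q).  The difference of the two
   sides is G 1 - G 0, where G' is the first-order remainder, at the points
   r = t + x (s - t) and rh = v + x (u - v), of the jointly convex function
   (z, r) |-> q z^2 r^(q-1). *)
Lemma powR_product_convex s t u v q :
  0 < s -> 0 < t -> 0 < u -> 0 < v -> 0 < q < 1 ->
  (u - v) * (u `^ q - v `^ q) +
    (u `^ q - v `^ q + q * u `^ (q - 1) * (u - v)) * (s - u) +
    (v `^ q - u `^ q + q * v `^ (q - 1) * (v - u)) * (t - v) <=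
  (s - t) * (s `^ q - t `^ q).
Proof.
move=> s0 t0 u0 v0 q01.
pose z := s - t; pose zt := u - v.
pose G x := z * ((t + x * z) `^ q - (v + x * zt) `^ q) -
  q * zt * ((v + x * zt) `^ (q - 1) * ((t - v) + x * (z - zt))).
pose dG x := z * (q * (t + x * z) `^ (q - 1) * z -
                  q * (v + x * zt) `^ (q - 1) * zt) -
  q * zt * ((v + x * zt) `^ (q - 1) * (z - zt) +
   ((t - v) + x * (z - zt)) * ((q - 1) * (v + x * zt) `^ (q - 1 - 1) * zt)).
have pos (a b x : R) : 0 < a -> 0 < b -> 0 <= x <= 1 -> 0 < b + x * (a - b).
  move=> a0 b0 x01; have [xh|xh] := leP x (1 / 2); nra.
have dGE (x : R) : x \in `[0, 1] -> is_derive x 1 G (dG x).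
  rewrite in_itv /= => x01.
  have d1 := @is_derive_powR_affine z t q x (pos _ _ _ s0 t0 x01).
  have d2 := @is_derive_powR_affine zt v q x (pos _ _ _ u0 v0 x01).
  have d3 := @is_derive_powR_affine zt v (q - 1) x (pos _ _ _ u0 v0 x01).
  have d4 := is_derive_affine (z - zt) (t - v) x.
  suff : is_derive x 1 (z \*: ((fun x => (t + x * z) `^ q) - (fun x => (v + x * zt) `^ q)) -
     (q * zt) \*: ((fun x => (v + x * zt) `^ (q - 1)) *
                   (fun x => (t - v) + x * (z - zt)))) (dG x) by [].
  by apply: is_derive_eq.
have dG0 (x : R) : x \in `[0, 1] -> 0 <= dG x.
  rewrite in_itv /= => x01.
  have := @perspective_derivative_ge0 z zt _ _ q
    (pos _ _ _ s0 t0 x01) (pos _ _ _ u0 v0 x01) q01.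
  have q0 : 0 <= q by lra.
  move=> /(mulr_ge0 q0) /le_trans; apply.
  by rewrite /dG -/z -/zt le_eqVlt; apply/orP; left; apply/eqP; ring.
have dG' (x : R) : x \in `]0, 1[ -> is_derive x 1 G (dG x).
  by rewrite in_itv /= => /andP[x0 x1]; apply: dGE; rewrite in_itv /= !ltW.
have cG : {within `[0, 1], continuous G}.
  by apply: derivable_within_continuous => x /dGE d; exact: ex_derive.
have [c c01 Gc] := MVT_segment ler01 dG' cG.
have : 0 <= G 1 - G 0 by rewrite Gc subr0 mulr1 dG0.
rewrite /G !mul0r !mul1r !addr0.
rewrite (_ : t + z = s); last by rewrite /z; ring.
rewrite (_ : v + zt = u); last by rewrite /zt; ring.
move=> G0; rewrite -subr_ge0; apply: le_trans G0 _.
rewrite le_eqVlt; apply/orP; left; apply/eqP; rewrite /z /zt; ring.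
Qed.

(** By symmetry t <= s. The tangent at t has slope q t^(q-1), and q - 1 < 0 makes this at most the
    slope at m. *)
Lemma powR_increment_le q m s t : 0 < q < 1 -> 0 < m -> m <= s -> m <= t ->
  (s - t) * (s `^ q - t `^ q) <= q * m `^ (q - 1) * (s - t) ^+ 2.
Proof.
move=> q01 m0; wlog st : s t / t <= s => [H ms mt|ms mt].
  have [?|/ltW ?] := leP t s; first exact: H.
  by rewrite -mulrNN !opprB (_ : (s - t) ^+ 2 = (t - s) ^+ 2); [exact: H|ring].
have t0 : 0 < t by exact: lt_le_trans mt.
have s0 : 0 < s by exact: lt_le_trans ms.
rewrite expr2 mulrA mulrC ler_wpM2r ?subr_ge0//.
rewrite lerBlDl (le_trans (powR_tangent_concave s0 t0 q01))// lerD2l.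
rewrite ler_wpM2r ?subr_ge0// ler_wpM2l; [|lra|].
  by [].
rewrite -(opprB 1 q) !powRN lef_pV2 ?posrE ?powR_gt0// ge0_ler_powR//.
all: rewrite ?nnegrE; lra.
Qed.

(** Here the tangent is taken at the larger point s, whose slope is at least the one at M. *)
Lemma powR_increment_ge q M s t : 0 < q < 1 -> 0 < s <= M -> 0 < t <= M ->
  q * M `^ (q - 1) * (s - t) ^+ 2 <= (s - t) * (s `^ q - t `^ q).
Proof.
move=> q01; wlog st : s t / t <= s => [H ms mt|/andP[s0 sM] /andP[t0 tM]].
  have [?|/ltW ?] := leP t s; first exact: H.
  by rewrite -[leRHS]mulrNN !opprB (_ : (s - t) ^+ 2 = (t - s) ^+ 2); [exact: H|ring].
rewrite expr2 mulrA mulrC ler_wpM2l ?subr_ge0//.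
have := powR_tangent_concave t0 s0 q01.
have : M `^ (q - 1) <= s `^ (q - 1).
  rewrite -(opprB 1 q) !powRN lef_pV2 ?posrE ?powR_gt0//; last exact: lt_le_trans sM.
  by rewrite ge0_ler_powR// ?nnegrE; lra.
move=> /(ler_wpM2r (_ : 0 <= q * (s - t))) => /(_ ltac:(nra)); nra.
Qed.

End PowerInequalities.

(** * The power entropy function, its derivative and truncation *)

Section PowerEntropyDensity.
Context {R : realType}.
Variable p : R.
Hypotheses (p_gt1 : 1 < p) (p_lt2 : p < 2).
Implicit Types r s m M : R.

Let p_gt0 : 0 < p. Proof. exact: lt_trans p_gt1. Qed.
Let pB1_gt0 : 0 < p - 1. Proof. by rewrite subr_gt0. Qed.
Let pB1_itv : 0 < p - 1 < 1. Proof. by rewrite pB1_gt0 ltrBlDr. Qed.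
Let pB1_inv_gt0 : 0 < (p - 1)^-1. Proof. by rewrite invr_gt0. Qed.
Let ppB1_inv_gt0 : 0 < (p * (p - 1))^-1.
Proof. by rewrite invr_gt0 mulr_gt0. Qed.

(** Closed form of Phi_p', identified with [derive1 (Phi p)] at positive arguments. *)
Definition dPhi r : R := (p * r `^ (p - 1) - 1) / (p * (p - 1)).

Lemma derive1_Phi r : 0 < r -> derive1 (Phi p) r = dPhi r.
Proof.
move=> r0; rewrite derive1E.
have -> : Phi p = (p * (p - 1))^-1 \*: ((fun r => r `^ p) - id).
  by apply/funext => x; rewrite /Phi /= mulrC.
have d := is_derive1_powR p r0.
rewrite derive_val /dPhi /GRing.scale /=; exact: mulrC.
Qed.

Lemma derive1_dPhi r : 0 < r -> derive1 (derive1 (Phi p)) r = r `^ (p - 1 - 1).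
Proof.
move=> r0; rewrite derive1E (@near_eq_derive _ _ _ _ dPhi); last first.
  near=> s; apply: derive1_Phi; near: s; exact: lt_nbhsr.
have -> : dPhi = (p * (p - 1))^-1 \*: (p \*: (fun r => r `^ (p - 1)) - cst 1).
  by apply/funext => x; rewrite /dPhi /= mulrC.
have d := is_derive1_powR (p - 1) r0.
rewrite derive_val /GRing.scale /= subr0; field.
by rewrite !gt_eqF.
Unshelve. all: by end_near.
Qed.

Lemma dPhiB r s : dPhi r - dPhi s = (p - 1)^-1 * (r `^ (p - 1) - s `^ (p - 1)).
Proof. by rewrite /dPhi; field; rewrite !gt_eqF. Qed.

(** Convexity bounds [Phi p r] with the slope at r; replacing it by the slope at s costs (r - s)(phi
    r - phi s), controlled because phi' is at most m^(p-2) above m. The constant is thus twice that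
    of a Taylor expansion. *)
Lemma Phi_le_quadratic m r s : 0 < m -> m <= r -> m <= s ->
  Phi p r <= Phi p s + dPhi s * (r - s) + m `^ (p - 1 - 1) * (r - s) ^+ 2.
Proof.
move=> m0 mr ms; have [r0 s0] := (lt_le_trans m0 mr, lt_le_trans m0 ms).
have q01 := pB1_itv.
have T := powR_tangent_convex s0 r0 p_gt1.
have I := powR_increment_le q01 m0 mr ms.
have c0 := ppB1_inv_gt0.
have q0 := pB1_inv_gt0.
have I' : (r - s) * (dPhi r - dPhi s) <= m `^ (p - 1 - 1) * (r - s) ^+ 2.
  rewrite dPhiB mulrCA (le_trans (ler_wpM2l (ltW q0) I))//.
  by rewrite -mulrA mulKf// gt_eqF.
have T' : Phi p r + dPhi r * (s - r) <= Phi p s.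
  rewrite -subr_ge0.
  have -> : Phi p s - (Phi p r + dPhi r * (s - r)) = (p * (p - 1))^-1 *
      (s `^ p - (r `^ p + p * r `^ (p - 1) * (s - r))).
    by rewrite /Phi /dPhi; field; rewrite !gt_eqF.
  by rewrite mulr_ge0 ?subr_ge0// ltW.
lra.
Qed.

(** The sum of both endpoint values covers increasing and decreasing powers at once. *)
Lemma powR_range_le m M r e : 0 < m -> m <= r <= M ->
  `|r `^ e| <= m `^ e + M `^ e.
Proof.
move=> m0 /andP[mr rM]; rewrite ger0_norm ?powR_ge0//.
have [e0|e0] := leP 0 e.
  rewrite -[leLHS]add0r lerD ?powR_ge0// ge0_ler_powR// nnegrE; lra.
rewrite -[leLHS]addr0 lerD ?powR_ge0// -(opprK e) !(powRN _ (- e)).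
rewrite lef_pV2 ?posrE ?powR_gt0//; last exact: lt_le_trans mr.
by rewrite ge0_ler_powR// ?nnegrE; lra.
Qed.

Lemma dPhi_range_le m M r : 0 < m -> m <= r <= M ->
  `|dPhi r| <= (p * (m `^ (p - 1) + M `^ (p - 1)) + 1) / (p * (p - 1)).
Proof.
move=> m0 mrM; have := powR_range_le (p - 1) m0 mrM => B.
have c0 := ppB1_inv_gt0.
rewrite /dPhi normrM (gtr0_norm c0) ler_wpM2r// ?(ltW c0)//.
rewrite (le_trans (ler_normB _ _))// normr1 lerD2r normrM gtr0_norm//.
by rewrite ler_wpM2l// ltW.
Qed.

(** Joint convexity of (s, t) |-> (s - t)(phi s - phi t) in tangent form: [powR_product_convex] with
    q = p - 1, divided by p - 1. *)
Lemma dPhi_increment_convex s t u v : 0 < s -> 0 < t -> 0 < u -> 0 < v ->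
  (u - v) * (dPhi u - dPhi v) +
    (dPhi u - dPhi v + u `^ (p - 1 - 1) * (u - v)) * (s - u) +
    (dPhi v - dPhi u + v `^ (p - 1 - 1) * (v - u)) * (t - v) <=
  (s - t) * (dPhi s - dPhi t).
Proof.
move=> s0 t0 u0 v0; have q01 := pB1_itv.
have q0 := pB1_inv_gt0.
have := ler_wpM2l (ltW q0) (powR_product_convex s0 t0 u0 v0 q01).
rewrite !dPhiB => H; rewrite [leRHS]mulrCA; apply: le_trans H.
by rewrite le_eqVlt; apply/orP; left; apply/eqP; field; rewrite gt_eqF.
Qed.

Lemma dPhi_increment_ge M s t : 0 < s <= M -> 0 < t <= M ->
  M `^ (p - 1 - 1) * (s - t) ^+ 2 <= (s - t) * (dPhi s - dPhi t).
Proof.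
move=> sM tM; have := powR_increment_ge pB1_itv sM tM.
move=> /(ler_wpM2l (ltW pB1_inv_gt0)).
by rewrite dPhiB -!mulrA mulKf ?gt_eqF// [leRHS]mulrCA.
Qed.

Lemma dPhi_le s t : 0 <= s -> s <= t -> dPhi s <= dPhi t.
Proof.
move=> s0 st; rewrite -subr_ge0 dPhiB mulr_ge0 ?(ltW pB1_inv_gt0)// subr_ge0.
by rewrite ge0_ler_powR ?(ltW pB1_gt0)// nnegrE (le_trans s0).
Qed.

Definition clamp m M r := Num.max m (Num.min r M).

Lemma clamp_range m M r : m <= M -> m <= clamp m M r <= M.
Proof. by move=> mM; rewrite /clamp le_max lexx/= ge_max mM ge_min lexx orbT. Qed.

Lemma le_clamp m M r : r <= M -> r <= clamp m M r.
Proof. by move=> rM; rewrite /clamp le_max le_min lexx rM orbT. Qed.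

Lemma clamp_leD m M r : 0 < m -> 0 < r -> clamp m M r <= r + m.
Proof.
move=> m0 r0; rewrite /clamp ge_max ge_min.
by rewrite lerDr (ltW r0) lerDl (ltW m0).
Qed.

(** For t <= s, either the truncated values coincide or truncation lowers s and raises t; both
    factors then shrink since phi is nondecreasing. *)
Lemma clamp_increment_le m M s t : 0 < m <= M -> 0 < s -> 0 < t ->
  (clamp m M s - clamp m M t) * (dPhi (clamp m M s) - dPhi (clamp m M t)) <=
  (s - t) * (dPhi s - dPhi t).
Proof.
move=> /andP[m0 mM]; wlog ts : s t / t <= s => [H s0 t0|s0 t0].
  have [?|/ltW st] := leP t s; first exact: H.
  rewrite -(opprB t s) -(opprB (dPhi t)) mulrNN.
  by rewrite -[leLHS]mulrNN !opprB; exact: H.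
have [le|lt] := leP (clamp m M s) (clamp m M t).
  have -> : clamp m M s = clamp m M t.
    apply/eqP; rewrite eq_le le /clamp ge_max le_max lexx/=.
    by rewrite le_max le_min !ge_min ts lexx !orbT.
  by rewrite subrr mul0r mulr_ge0 ?subr_ge0// dPhi_le// ltW.
have [ss tt] : clamp m M s <= s /\ t <= clamp m M t.
  move: lt; rewrite /clamp.
  by case: (leP s M) => ?; case: (leP t M) => ?; repeat (case: (leP m _) => ?); lra.
have c0 : 0 <= clamp m M s.
  by have /andP[+ _] := clamp_range s mM; apply: le_trans; exact: ltW.
apply: ler_pM; rewrite ?subr_ge0; [exact: ltW|apply: dPhi_le|exact: lerB|apply: lerB].
- by have /andP[+ _] := clamp_range t mM; apply: le_trans; exact: ltW.
- exact: ltW.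
- exact: dPhi_le.
- by apply: dPhi_le => //; exact: ltW.
Qed.

Lemma derive1_Upsilon r : derive1 (@Upsilon R) r = expR r - 1.
Proof.
rewrite derive1E.
have -> : @Upsilon R = expR - cst 1 - id by [].
by rewrite derive_val subr0.
Qed.

End PowerEntropyDensity.

(** * Reversible rates *)

Section ReversibleRates.
Context {R : realType} {X : countType}.
Variables (k : X -> X -> R) (dens : X -> R).
Hypothesis k_rates : transition_rates k.
Hypothesis dens_gt0 : forall x, 0 < dens x.
Hypothesis dens_sum1 : (\esum_(x in [set: X]) (dens x)%:E = 1)%E.
Hypothesis k_db : detailed_balance k dens.
Hypothesis M1_l2 : in_lp dens 2 (fine \o M1 k).
Implicit Types f g u v : X -> R.

Local Notation L := (generator k).

Definition exit_rate x : R := - k x x.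

(** The symmetric conductance of the reversible chain. The negative diagonal rate is replaced by 0,
    which changes no sum of increments. *)
Definition flow (z : X * X) : R :=
  if z.1 == z.2 then 0 else dens z.1 * k z.1 z.2.

Lemma flow_ge0 z : 0 <= flow z.
Proof.
rewrite /flow; case: eqVneq => // zz.
by rewrite mulr_ge0 ?(ltW (dens_gt0 _))//; exact: k_rates.1.
Qed.

Lemma flowC x y : flow (y, x) = flow (x, y).
Proof. by rewrite /flow /= eq_sym; case: eqVneq => // _; rewrite k_db. Qed.

Lemma exit_rate_ge0 x : 0 <= exit_rate x.
Proof. by rewrite oppr_ge0 ltW//; case: (k_rates.2 x). Qed.

Lemma EFin_exit_rate x : (exit_rate x)%:E = M1 k x.
Proof. by case: (k_rates.2 x) => ->. Qed.

Lemma esum_flow x :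
  (\esum_(y in [set: X]) (flow (x, y))%:E = (dens x * exit_rate x)%:E)%E.
Proof.
rewrite EFinM EFin_exit_rate /M1 [X in (_ * X)%E]esum_mkcond.
have H y : (if y \in [set y | y != x] then (k x y)%:E else 0)%E =
    (if x == y then 0 else k x y)%:E.
  rewrite (_ : (y \in [set y | y != x]) = (y != x)) 1?eq_sym; first by case: eqVneq.
  by apply/idP/idP; rewrite inE /= eq_sym.
under [in RHS]eq_esum do rewrite H.
rewrite -ge0_esumZ ?(ltW (dens_gt0 _))//.
  by apply: eq_esum => y _; rewrite /flow /=; case: eqVneq; rewrite ?mulr0.
by move=> y; case: eqVneq => // xy; exact: k_rates.1.
Qed.

Lemma abs_summable_flow_row x : abs_summable (fun y => flow (x, y)).
Proof.
by apply: ge0_abs_summable => [y|]; rewrite ?flow_ge0// esum_flow ltry.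
Qed.

Lemma rsum_flow_row x : rsum (fun y => flow (x, y)) = dens x * exit_rate x.
Proof.
by rewrite rsumE ?esum_flow// => y; exact: flow_ge0.
Qed.

Lemma abs_summable_dens : abs_summable dens.
Proof.
by apply: ge0_abs_summable => [x|]; rewrite ?(ltW (dens_gt0 _))// dens_sum1 ltry.
Qed.

Lemma rsum_dens : rsum dens = 1.
Proof. by rewrite rsumE ?dens_sum1// => x; exact: ltW. Qed.

(** M_1 in l^2(mu) enters through (1 + a)^2 <= 2 + 2 a^2; the later summability statements reduce to
    this one. *)
Lemma abs_summable_dens_sq : abs_summable (fun x => dens x * (1 + exit_rate x) ^+ 2).
Proof.
have s2 : abs_summable (fun x => exit_rate x ^+ 2 * dens x).
  apply: ge0_abs_summable => [x|]; first by rewrite mulr_ge0 ?sqr_ge0// ltW.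
  move: M1_l2; rewrite /in_lp; congr (_ < _)%E; apply: eq_esum => x _ /=.
  rewrite -EFin_exit_rate /= ger0_norm ?exit_rate_ge0// -powR_mulrn//.
  exact: exit_rate_ge0.
apply: abs_summable_le
  (abs_summableD (abs_summableZ 2 abs_summable_dens) (abs_summableZ 2 s2)) => x.
rewrite ger0_norm; last by rewrite mulr_ge0 ?sqr_ge0// ltW.
have := mulr_ge0 (ltW (dens_gt0 x)) (sqr_ge0 (1 - exit_rate x)).
by rewrite /=; lra.
Qed.

(** The growth class containing L v for bounded v. A product of two of its members is integrable
    against mu. *)
Definition lin_bounded u := exists C, forall x, `|u x| <= C * (1 + exit_rate x).

Definition sup_bounded u := exists C, forall x, `|u x| <= C.

Lemma one_exit_ge1 x : 1 <= 1 + exit_rate x.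
Proof. by rewrite lerDl exit_rate_ge0. Qed.

Lemma sup_bounded_lin u : sup_bounded u -> lin_bounded u.
Proof.
move=> [C uC]; exists `|C| => x; rewrite (le_trans (uC x))//.
by rewrite (le_trans (ler_norm C))// ler_peMr// one_exit_ge1.
Qed.

Lemma lin_boundedD u v :
  lin_bounded u -> lin_bounded v -> lin_bounded (fun x => u x + v x).
Proof.
move=> [C uC] [D vD]; exists (C + D) => x.
by rewrite (le_trans (ler_normD _ _))// mulrDl lerD.
Qed.

Lemma lin_boundedN u : lin_bounded u -> lin_bounded (fun x => - u x).
Proof. by move=> [C uC]; exists C => x; rewrite normrN. Qed.

Lemma lin_boundedM u v :
  sup_bounded u -> lin_bounded v -> lin_bounded (fun x => u x * v x).
Proof.
move=> [C uC] [D vD]; exists (C * D) => x.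
by rewrite normrM -mulrA ler_pM.
Qed.

Lemma sup_boundedM u v :
  sup_bounded u -> sup_bounded v -> sup_bounded (fun x => u x * v x).
Proof. by move=> [C uC] [D vD]; exists (C * D) => x; rewrite normrM ler_pM. Qed.

Lemma sup_boundedB u v :
  sup_bounded u -> sup_bounded v -> sup_bounded (fun x => u x - v x).
Proof.
move=> [C uC] [D vD]; exists (C + D) => x.
by rewrite (le_trans (ler_normB _ _))// lerD.
Qed.

Lemma abs_summable_densM u v : lin_bounded u -> lin_bounded v ->
  abs_summable (fun x => dens x * (u x * v x)).
Proof.
move=> [C uC] [D vD].
apply: abs_summable_le (abs_summableZ (C * D) abs_summable_dens_sq) => x.
rewrite normrM (gtr0_norm (dens_gt0 x)) mulrCA ler_wpM2l ?(ltW (dens_gt0 _))//.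
rewrite normrM expr2 mulrACA ler_pM//.
Qed.

Lemma abs_summable_dens1 u : lin_bounded u -> abs_summable (fun x => dens x * u x).
Proof.
move=> lu; apply: eq_abs_summable (@abs_summable_densM u (fun=> 1) lu _).
  by move=> x; rewrite mulr1.
by apply: sup_bounded_lin; exists 1 => x; rewrite normr1.
Qed.

Lemma abs_summable_flow_exit1 :
  abs_summable (fun z => flow z * (1 + exit_rate z.1)).
Proof.
apply: abs_summable_pair.
- by move=> z; rewrite mulr_ge0 ?flow_ge0// (le_trans ler01)// one_exit_ge1.
- move=> x /=; under [X in abs_summable X]funext do rewrite mulrC.
  by apply: abs_summableZ; exact: abs_summable_flow_row.
- apply: abs_summable_le abs_summable_dens_sq => x /=.
  under eq_rsum do rewrite mulrC.
  rewrite rsumZ; last exact: abs_summable_flow_row.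
  have m0 := exit_rate_ge0 x; have d0 := ltW (dens_gt0 x).
  rewrite rsum_flow_row ger0_norm; last by rewrite !mulr_ge0// addr_ge0.
  rewrite expr2 mulrCA ler_wpM2l// ler_wpM2l// ?addr_ge0//; lra.
Qed.

(** The exit rate at the second endpoint is handled by swapping, since the flow is symmetric. *)
Lemma abs_summable_flowM (h : X * X -> R) (C : R) :
  (forall z, `|h z| <= C * ((1 + exit_rate z.1) + (1 + exit_rate z.2))) ->
  abs_summable (fun z => flow z * h z).
Proof.
move=> hC; have s1 := abs_summable_flow_exit1.
have := abs_summableZ C (abs_summableD s1 (abs_summable_swap s1)).
apply: abs_summable_le => -[x y] /=; rewrite normrM (ger0_norm (flow_ge0 _)).
rewrite flowC -mulrDr mulrCA ler_wpM2l ?flow_ge0//; exact: hC.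
Qed.

Lemma abs_summable_flow_increment u v : sup_bounded u -> lin_bounded v ->
  abs_summable (fun z => flow z * (u z.1 * (v z.2 - v z.1))).
Proof.
move=> [C uC] [D vD]; apply: (@abs_summable_flowM _ (C * D)) => z.
rewrite normrM -mulrA ler_pM// mulrDr (le_trans (ler_normB _ _))//.
by rewrite addrC lerD.
Qed.

Lemma abs_summable_flow_row_increment v x : lin_bounded v ->
  abs_summable (fun y => flow (x, y) * (v y - v x)).
Proof.
move=> lv.
have b1 : sup_bounded (fun _ => 1) by exists 1 => ?; rewrite normr1.
have := abs_summable_row x (abs_summable_flow_increment b1 lv).
by apply: eq_abs_summable => y /=; rewrite mul1r.
Qed.

Lemma rate_incrementE v x y :
  k x y * (v y - v x) = (dens x)^-1 * (flow (x, y) * (v y - v x)).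
Proof.
rewrite /flow /=; case: eqVneq => [->|_]; first by rewrite subrr !mulr0.
by rewrite -!mulrA mulKf// gt_eqF.
Qed.

Lemma abs_summable_rate_increment v x : lin_bounded v ->
  abs_summable (fun y => k x y * (v y - v x)).
Proof.
move=> lv; apply: eq_abs_summable
  (abs_summableZ (dens x)^-1 (abs_summable_flow_row_increment x lv)) => y.
by rewrite rate_incrementE.
Qed.

Lemma generatorE v x : lin_bounded v ->
  dens x * L v x = rsum (fun y => flow (x, y) * (v y - v x)).
Proof.
move=> lv; rewrite /generator (eq_rsum (rate_incrementE v x)).
rewrite rsumZ; last exact: abs_summable_flow_row_increment.
by rewrite mulVKf// gt_eqF.
Qed.

Lemma generator_norm_le v C x : (forall x, `|v x| <= C) ->
  `|L v x| <= 2 * C * exit_rate x.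
Proof.
move=> vC; have bv : sup_bounded v by exists C.
have lv := sup_bounded_lin bv.
rewrite -(ler_pM2l (dens_gt0 x)) -[X in X * `|_|](gtr0_norm (dens_gt0 x)) -normrM.
rewrite generatorE// mulrCA -rsum_flow_row -rsumZ; last exact: abs_summable_flow_row.
have le y : `|flow (x, y) * (v y - v x)| <= 2 * C * flow (x, y).
  rewrite normrM (ger0_norm (flow_ge0 _)) mulrC ler_wpM2r ?flow_ge0//.
  by rewrite (le_trans (ler_normB _ _))// mulr2n mulrDl mul1r lerD.
have sC := abs_summableZ (2 * C) (abs_summable_flow_row x).
have s := abs_summable_le le sC.
rewrite (le_trans (rsum_norm s))// ler_rsum//; exact: abs_summable_norm.
Qed.

Lemma lin_bounded_generator v : sup_bounded v -> lin_bounded (L v).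
Proof.
move=> [C vC]; exists (2 * C) => x; rewrite (le_trans (generator_norm_le x vC))//.
rewrite ler_wpM2l//; last by rewrite lerDr.
by rewrite mulr_ge0// (le_trans _ (vC x)).
Qed.

(** Summed over ordered pairs without the usual factor 1/2, so this is twice the Dirichlet form. *)
Definition dirichlet u v : R :=
  rsum (fun z => flow z * ((u z.2 - u z.1) * (v z.2 - v z.1))).

Lemma dirichletC u v : dirichlet u v = dirichlet v u.
Proof. by apply: eq_rsum => z; rewrite (mulrC (u _ - _)). Qed.

Lemma abs_summable_dirichlet u v : sup_bounded u -> lin_bounded v ->
  abs_summable (fun z => flow z * ((u z.2 - u z.1) * (v z.2 - v z.1))).
Proof.
move=> bu lv; have s := abs_summable_flow_increment bu lv.
have := abs_summableN (abs_summableD s (abs_summable_swap s)).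
by apply: eq_abs_summable => -[x y] /=; rewrite flowC; ring.
Qed.

(** Adding the summand to its swap gives minus the product of the two increments. *)
Lemma rsum_increment_dirichlet u v :
  abs_summable (fun z => flow z * (u z.1 * (v z.2 - v z.1))) ->
  rsum (fun z => flow z * (u z.1 * (v z.2 - v z.1))) = - 2^-1 * dirichlet u v.
Proof.
set F := (X in rsum X) => sF.
have : rsum (fun z => - (F z + F (z.2, z.1))) = dirichlet u v.
  by apply: eq_rsum => -[x y]; rewrite /F /= flowC; ring.
rewrite rsumN; last by apply: abs_summableD => //; exact: abs_summable_swap.
rewrite rsumD//; last exact: abs_summable_swap.
rewrite rsum_swap; lra.
Qed.

Lemma row_incrementE u v x : lin_bounded v ->
  rsum (fun y => flow (x, y) * (u x * (v y - v x))) = dens x * (u x * L v x).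
Proof.
move=> lv; rewrite mulrCA generatorE// -rsumZ.
  by apply: eq_rsum => y /=; rewrite mulrCA.
exact: abs_summable_flow_row_increment.
Qed.

Lemma abs_summable_generator u v : sup_bounded u -> lin_bounded v ->
  abs_summable (fun x => dens x * (u x * L v x)).
Proof.
move=> bu lv.
apply: eq_abs_summable (abs_summable_row_sum (abs_summable_flow_increment bu lv)).
by move=> x; exact: row_incrementE.
Qed.

Lemma rsum_increment u v : lin_bounded v ->
  abs_summable (fun z => flow z * (u z.1 * (v z.2 - v z.1))) ->
  rsum (fun z => flow z * (u z.1 * (v z.2 - v z.1))) =
  rsum (fun x => dens x * (u x * L v x)).
Proof.
move=> lv s; rewrite rsum_pair//; apply: eq_rsum => x; exact: row_incrementE.
Qed.

Lemma rsum_generator u v : sup_bounded u -> lin_bounded v ->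
  rsum (fun x => dens x * (u x * L v x)) = - 2^-1 * dirichlet u v.
Proof.
move=> bu lv; have s := abs_summable_flow_increment bu lv.
by rewrite -rsum_increment// rsum_increment_dirichlet.
Qed.

(** Here the bounded increment of v compensates the growth of u. With [rsum_generator] this makes L
    symmetric between a bounded function and one of linear growth in the exit rate. *)
Lemma rsum_generator_lin u v : lin_bounded u -> sup_bounded v ->
  rsum (fun x => dens x * (u x * L v x)) = - 2^-1 * dirichlet u v.
Proof.
move=> lu bv.
have s : abs_summable (fun z => flow z * (u z.1 * (v z.2 - v z.1))).
  have [[C uC] [D vD]] := (lu, bv); apply: (@abs_summable_flowM _ (C * (D + D))) => z.
  have D0 : 0 <= D + D by rewrite addr_ge0// (le_trans _ (vD z.1)).
  have C0 : 0 <= C.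
    have := le_trans (normr_ge0 _) (uC z.1).
    by rewrite pmulr_lge0// (lt_le_trans _ (one_exit_ge1 _)).
  rewrite mulrAC normrM; apply: ler_pM => //; last first.
    by rewrite (le_trans (ler_normB _ _))// lerD.
  rewrite (le_trans (uC _))// ler_wpM2l//.
  by rewrite lerDl (le_trans _ (one_exit_ge1 _)).
by rewrite -rsum_increment ?rsum_increment_dirichlet//; exact: sup_bounded_lin.
Qed.

(** * Fisher information and the curvature condition *)

Variables p kappa : R.
Hypotheses (p_gt1 : 1 < p) (p_lt2 : p < 2).

Local Notation phi := (dPhi p).

Definition in_range (m M : R) g := 0 < m /\ forall x, m <= g x <= M.

Lemma in_range_gt0 m M g x : in_range m M g -> 0 < g x.
Proof. by move=> [m0 /(_ x)/andP[mg _]]; exact: lt_le_trans mg. Qed.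

Lemma sup_bounded_range m M g : in_range m M g -> sup_bounded g.
Proof.
move=> gr; exists M => x; have := in_range_gt0 x gr => gx.
by rewrite gtr0_norm//; have /andP[] := gr.2 x.
Qed.

Lemma sup_bounded_powR m M g e : in_range m M g ->
  sup_bounded (fun x => g x `^ e).
Proof.
by move=> [m0 gr]; exists (m `^ e + M `^ e) => x; exact: powR_range_le.
Qed.

Lemma sup_bounded_dPhi m M g : in_range m M g -> sup_bounded (phi \o g).
Proof.
move=> [m0 gr]; exists ((p * (m `^ (p - 1) + M `^ (p - 1)) + 1) / (p * (p - 1))).
by move=> x; exact: dPhi_range_le.
Qed.

Lemma in_range_linfty_plus m M g (x : X) : in_range m M g -> linfty_plus g.
Proof.
move=> gr; have [m0 mM] := gr; split.
  rewrite /bounded_fun /bounded_near; near=> K => y _ /=.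
  rewrite ger0_norm; last exact/ltW/(in_range_gt0 y gr).
  have /andP[_ gM] := mM y; apply: le_trans gM _.
  near: K; apply: nbhs_pinfty_ge; exact: num_real.
(* The point x makes the range nonempty, so that a lower bound passes to the infimum. *)
apply: lt_le_trans m0 _; apply: lb_le_inf; first by exists (g x), x.
by move=> _ [y _ <-]; have /andP[] := mM y.
Unshelve. all: by end_near.
Qed.

(** Real-valued form of [fisher], used when the defining sum converges. *)
Definition fisher_form g : R := 2^-1 * dirichlet g (phi \o g).

Lemma PsiE m M g x : in_range m M g ->
  Psi k p g x = g x `^ (p - 1 - 1) * L g x - L (phi \o g) x.
Proof.
move=> gr; have gx := in_range_gt0 _ gr.
have lg := sup_bounded_lin (sup_bounded_range gr).
have lphi := sup_bounded_lin (sup_bounded_dPhi gr).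
have s1 := abs_summable_rate_increment x lg.
have s2 := abs_summable_rate_increment x lphi.
rewrite /Psi /generator -rsumZ// -rsumB//; last exact: abs_summableZ.
rewrite -rsumN; last first.
  apply: eq_abs_summable (abs_summableB s2 (abs_summableZ (g x `^ (p - 1 - 1)) s1)) => y.
  rewrite /Lambda !derive1_Phi// derive1_dPhi//=; ring.
apply: eq_rsum => y; rewrite /Lambda !derive1_Phi// derive1_dPhi//=; ring.
Qed.

(** Since exp (log g(y) - log g(x)) - 1 = (g(y) - g(x)) / g(x), the weight g(x) clears the
    denominator. This is why the curvature condition is summed against g dens. *)
Lemma BformE m M g v x : in_range m M g -> lin_bounded v ->
  dens x * (g x * Bform k (derive1 (@Upsilon R)) (@ln R \o g) v x) =
  rsum (fun y => flow (x, y) * ((g y - g x) * (v y - v x))).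
Proof.
move=> gr lv; have gx := in_range_gt0 _ gr.
have := abs_summable_row x (abs_summable_dirichlet (sup_bounded_range gr) lv).
set F := (fun y => _) => sF.
rewrite mulrA /Bform (eq_rsum (g := fun y => (dens x * g x)^-1 * F y)); last first.
  move=> y; rewrite derive1_Upsilon /= expRB !lnK ?posrE//.
  rewrite /F /flow /=; case: eqVneq => [->|_]; first by rewrite subrr !mulr0.
  by field; rewrite !gt_eqF.
by rewrite rsumZ// mulVKf// mulf_neq0// gt_eqF.
Qed.

(** The curvature condition at x is multiplied by g(x) dens(x) and summed. Integration by parts
    turns the left side into kappa times the Fisher information and the right side into half of the
    stated sum. *)
Lemma CD_fisher_form m M g : CD_Upsilon k p kappa -> in_range m M g ->
  2 * kappa * fisher_form g <=
  rsum (fun x => dens x * ((L (phi \o g) x + g x `^ (p - 1 - 1) * L g x) * L g x)).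
Proof.
move=> CD gr; have gx := in_range_gt0 _ gr.
have bg := sup_bounded_range gr; have lg := sup_bounded_lin bg.
have bphi := sup_bounded_dPhi gr; have lphi := sup_bounded_lin bphi.
have ls := lin_bounded_generator bg.
have lv := lin_bounded_generator bphi.
have bq := sup_bounded_powR (p - 1) gr.
have lpsi : lin_bounded (Psi k p g).
  rewrite (funext (fun x => PsiE x gr)).
  apply: lin_boundedD; last exact: lin_boundedN.
  exact/lin_boundedM/ls/(sup_bounded_powR _ gr).
pose Bf := Bform k (derive1 (@Upsilon R)) (@ln R \o g) (L (phi \o g)).
have sB : abs_summable (fun x => dens x * (g x * Bf x)).
  apply: eq_abs_summable (abs_summable_row_sum (abs_summable_dirichlet bg lv)) => x.
  by rewrite (BformE x gr lv).
have EB : rsum (fun x => dens x * (g x * Bf x)) = dirichlet g (L (phi \o g)).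
  rewrite /dirichlet rsum_pair; last exact: abs_summable_dirichlet.
  by apply: eq_rsum => x; rewrite (BformE x gr lv).
have sL := abs_summable_generator bg lpsi.
have sP := abs_summable_densM lg lpsi.
(* L is moved from Psi, which may be unbounded, to the bounded g through the symmetry of the
   Dirichlet form. *)
have EL : rsum (fun x => dens x * (g x * L (Psi k p g) x)) =
    rsum (fun x => dens x * (Psi k p g x * L g x)).
  by rewrite rsum_generator// dirichletC rsum_generator_lin.
have Ev := rsum_generator_lin lv bg.
(* As g g^(p-2) = g^(p-1) has increments (p - 1) times those of phi(g), the two terms of Psi
   contribute -(p - 1) and 1 Fisher informations, hence 2 - p. *)
have EP : rsum (fun x => dens x * (g x * Psi k p g x)) = (2 - p) * fisher_form g.
  rewrite (eq_rsum (g := fun x => dens x * (g x `^ (p - 1) * L g x) -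
                        dens x * (g x * L (phi \o g) x))); last first.
    move=> x; rewrite (PsiE x gr) -(@mulr_powRB1 _ (g x) (p - 1)) ?subr_gt0//; first ring.
    exact: ltW.
  rewrite rsumB; [|exact: abs_summable_generator..].
  rewrite !rsum_generator// /fisher_form.
  rewrite (_ : dirichlet (fun x => g x `^ (p - 1)) g = (p - 1) * dirichlet g (phi \o g)).
    by ring.
  rewrite dirichletC -rsumZ; last exact: abs_summable_dirichlet.
  apply: eq_rsum => z /=; rewrite dPhiB//; field.
  by rewrite gt_eqF// subr_gt0.
have := @ler_rsum _ _ (fun x => kappa / (2 - p) * (dens x * (g x * Psi k p g x)))
  (fun x => 2^-1 * (dens x * (g x * L (Psi k p g) x) - dens x * (g x * Bf x))).
rewrite rsumZ// rsumZ; last exact: abs_summableB.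
rewrite rsumB// EP EB EL (dirichletC g).
have sPs := abs_summable_densM lpsi ls; have sVs := abs_summable_densM lv ls.
have -> : rsum (fun x => dens x * ((L (phi \o g) x + g x `^ (p - 1 - 1) * L g x) * L g x)) =
    rsum (fun x => dens x * (Psi k p g x * L g x)) +
    2 * rsum (fun x => dens x * (L (phi \o g) x * L g x)).
  rewrite -rsumZ// -rsumD//; last exact: abs_summableZ.
  by apply: eq_rsum => x; rewrite (PsiE x gr); ring.
have -> : kappa / (2 - p) * ((2 - p) * fisher_form g) = kappa * fisher_form g.
  by field; rewrite gt_eqF// subr_gt0.
rewrite {}Ev => H.
suff : kappa * fisher_form g <= 2^-1 *
  (rsum (fun x => dens x * (Psi k p g x * L g x)) - dirichlet (L (phi \o g)) g) by lra.
apply: H; [exact: abs_summableZ|exact/abs_summableZ/abs_summableB|].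
move=> x; have := CD g x (in_range_linfty_plus x gr).
have Ephi : derive1 (Phi p) \o g = phi \o g.
  by apply/funext => y /=; rewrite derive1_Phi.
rewrite /Psi2 Ephi -/(Bf x).
have d0 : 0 <= dens x * g x by rewrite mulr_ge0// ltW.
move=> /(ler_wpM2l d0); rewrite /=; lra.
Qed.

(** The tangent inequality [dPhi_increment_convex] is summed over edges, with base point g;
    integration by parts expresses the linear term through L. *)
Lemma fisher_form_convex m M f g : in_range m M f -> in_range m M g ->
  fisher_form g + rsum (fun x => dens x *
    ((L (phi \o g) x + g x `^ (p - 1 - 1) * L g x) * (g x - f x))) <= fisher_form f.
Proof.
move=> fr gr; have gx x := in_range_gt0 x gr; have fx x := in_range_gt0 x fr.
have bg := sup_bounded_range gr; have lg := sup_bounded_lin bg.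
have bf := sup_bounded_range fr.
have bphi := sup_bounded_dPhi gr; have lphi := sup_bounded_lin bphi.
have bphif := sup_bounded_dPhi fr.
have bw : sup_bounded (fun x => g x - f x) by exact: sup_boundedB.
have bwq := sup_boundedM bw (sup_bounded_powR (p - 1 - 1) gr).
have s1 := abs_summable_flow_increment bw lphi.
have s2 := abs_summable_flow_increment bwq lg.
have s12 := abs_summableD s1 s2.
have sK := abs_summableD s12 (abs_summable_swap s12).
have sg := abs_summable_dirichlet bg lphi.
have sf := abs_summable_dirichlet bf (sup_bounded_lin bphif).
have H := ler_rsum (abs_summableD sg sK) sf.
have {H} : dirichlet g (phi \o g) + 2 * rsum (fun x => dens x *
    ((L (phi \o g) x + g x `^ (p - 1 - 1) * L g x) * (g x - f x))) <=
    dirichlet f (phi \o f).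
  rewrite (eq_rsum (f := fun x => dens x * _) (g := fun x =>
    dens x * ((g x - f x) * L (phi \o g) x) +
    dens x * ((g x - f x) * g x `^ (p - 1 - 1) * L g x))); last first.
    by move=> x; ring.
  rewrite rsumD; [|exact: abs_summable_generator..].
  rewrite -(rsum_increment lphi s1) -(rsum_increment lg s2) -(rsumD s1 s2).
  (* The two endpoints contribute equally, being swaps of each other. *)
  have -> : forall K : X * X -> R, abs_summable K ->
      2 * rsum K = rsum (fun z => K z + K (z.2, z.1)).
    move=> K sK'; rewrite rsumD ?rsum_swap//; last exact: abs_summable_swap.
    lra.
  - rewrite /dirichlet -(rsumD sg sK); apply: H => -[x y] /=.
    have := dPhi_increment_convex p_gt1 p_lt2 (fx y) (fx x) (gx y) (gx x).
    move=> /(ler_wpM2l (flow_ge0 (x, y))) I; apply: le_trans I.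
    by rewrite flowC le_eqVlt; apply/orP; left; apply/eqP; ring.
  - exact: s12.
rewrite /fisher_form.
by move: (dirichlet f _) (dirichlet g _) (rsum _) => a b c; lra.
Qed.

(** * Implicit Euler steps *)

Lemma abs_summable_flow_row_mul g x : sup_bounded g ->
  abs_summable (fun y => flow (x, y) * g y).
Proof.
move=> [C gC]; apply: abs_summable_le (abs_summableZ C (abs_summable_flow_row x)) => y.
by rewrite normrM (ger0_norm (flow_ge0 _)) mulrC ler_wpM2r// flow_ge0.
Qed.

Lemma generator_flowE g x : sup_bounded g ->
  dens x * L g x = rsum (fun y => flow (x, y) * g y) - dens x * exit_rate x * g x.
Proof.
move=> bg; rewrite generatorE; last exact: sup_bounded_lin.
rewrite -rsum_flow_row mulrC -rsumZ; last exact: abs_summable_flow_row.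
rewrite -rsumB.
- by apply: eq_rsum => y; ring.
- exact: abs_summable_flow_row_mul.
- exact/abs_summableZ/abs_summable_flow_row.
Qed.

(* The solution is the largest post-fixed point of the monotone map A, which
   preserves [m, M]. *)
Lemma resolvent_exists m M f h : in_range m M f -> 0 < h ->
  exists2 g, in_range m M g & forall x, f x = g x - h * L g x.
Proof.
move=> [m0 fr] h0.
pose c x := dens x * (1 + h * exit_rate x).
have c0 x : 0 < c x.
  by rewrite mulr_gt0// ltr_wpDr// mulr_ge0 ?exit_rate_ge0// ltW.
(* The equation solved for its diagonal value: [A u x] is the g(x) determined by f(x) and the values
   of u at the neighbours. *)
pose A u x := (dens x * f x + h * rsum (fun y => flow (x, y) * u y)) / c x.
pose between u := forall x, m <= u x <= M.
have bnd u : between u -> sup_bounded u.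
  move=> bu; exists M => x; have /andP[mu uM] := bu x.
  by rewrite ger0_norm// (le_trans _ mu)// ltW.
have Amono u v : sup_bounded u -> sup_bounded v -> (forall x, u x <= v x) ->
    forall x, A u x <= A v x.
  move=> bu bv uv x; rewrite ler_pM2r ?invr_gt0// lerD2l ler_pM2l//.
  apply: ler_rsum; [exact: abs_summable_flow_row_mul..|].
  by move=> y; rewrite ler_wpM2l ?flow_ge0.
(* Constants are moved towards f, so m is a subsolution and M a supersolution. *)
have Acst b x : A (fun=> b) x = b + dens x * (f x - b) / c x.
  rewrite /A (eq_rsum (g := fun y => b * flow (x, y))); last by move=> y; rewrite mulrC.
  rewrite rsumZ ?rsum_flow_row; last exact: abs_summable_flow_row.
  have d0 : dens x != 0 by rewrite gt_eqF.
  have e0 : 1 + h * exit_rate x != 0.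
    by have := c0 x; rewrite /c lt0r mulf_eq0 negb_or => /andP[/andP[_ ->]].
  by rewrite /c; field; rewrite d0 e0.
have Abetween u : between u -> between (A u).
  move=> bu x; have bc b : sup_bounded (fun _ : X => b) by exists `|b|.
  have /andP[mf fM] := fr x; apply/andP; split.
    apply: (@le_trans _ _ (A (fun=> m) x)).
      by rewrite Acst lerDl divr_ge0 ?(ltW (c0 x))// mulr_ge0 ?subr_ge0// ltW.
    by apply: Amono => //; [exact: bnd|move=> y; have /andP[] := bu y].
  apply: (@le_trans _ _ (A (fun=> M) x)).
    by apply: Amono => //; [exact: bnd|move=> y; have /andP[] := bu y].
  rewrite Acst gerDl mulr_le0_ge0 ?invr_ge0 ?(ltW (c0 x))//.
  by rewrite mulr_ge0_le0 ?subr_le0// ltW.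
pose S := [set u | between u /\ forall x, u x <= A u x].
pose g x := sup [set u x | u in S].
have Sm : S (fun=> m).
  split=> [x|x]; first by rewrite lexx/=; have /andP[mf /(le_trans mf)] := fr x.
  have /andP[mf _] := fr x.
  by rewrite Acst lerDl divr_ge0 ?(ltW (c0 x))// mulr_ge0 ?subr_ge0// ltW.
have ubS x : ubound [set u x | u in S] M.
  by move=> _ [u [bu _] <-]; have /andP[] := bu x.
have leg u x : S u -> u x <= g x.
  move=> Su; apply: ub_le_sup; last by exists u.
  by exists M; exact: ubS.
have gbetween : between g.
  move=> x; rewrite (leg _ x Sm)/=; apply: ge_sup; last exact: ubS.
  by exists m, (fun=> m).
have gA x : g x <= A g x.
  apply: ge_sup; first by exists m, (fun=> m).
  move=> _ [u Su <-]; have [bu uA] := Su; rewrite (le_trans (uA x))//.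
  by apply: Amono; [exact: bnd|exact: bnd|move=> y; exact: leg].
(* By monotonicity [A g] is again a post-fixed point, hence lies below the supremum g. *)
have Ag x : A g x <= g x.
  apply: leg; split; first exact: Abetween.
  by apply: Amono; [exact: bnd|exact/bnd/Abetween|exact: gA].
exists g => // x; have d0 : dens x != 0 by rewrite gt_eqF.
have gE : g x = A g x by apply/eqP; rewrite eq_le gA Ag.
apply: (mulfI d0); rewrite mulrBr mulrCA generator_flowE; last exact: bnd.
move: gE => /(congr1 (fun r => r * c x)).
rewrite /A divfK; last by rewrite gt_eqF.
by rewrite /c => E; lra.
Qed.

Definition mean_entropy u : R := rsum (fun x => Phi p (u x) * dens x).

Lemma sup_bounded_Phi m M u : in_range m M u -> sup_bounded (fun x => Phi p (u x)).
Proof.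
move=> ur; have b1 := sup_bounded_powR p ur.
have := sup_boundedM (sup_boundedB b1 (sup_bounded_range ur)) _; apply.
by exists `|(p * (p - 1))^-1|.
Qed.

Lemma abs_summable_mul_dens u : sup_bounded u ->
  abs_summable (fun x => u x * dens x).
Proof.
move=> /sup_bounded_lin/abs_summable_dens1; apply: eq_abs_summable => x.
exact: mulrC.
Qed.

(** * Estimates for a single implicit step *)

Section ImplicitEulerStep.
Variables (m M h : R) (f g : X -> R).
Hypotheses (fr : in_range m M f) (gr : in_range m M g) (h_gt0 : 0 < h).
Hypothesis fE : forall x, f x = g x - h * L g x.

Let bg := sup_bounded_range gr.
Let lg := sup_bounded_lin bg.
Let ls : lin_bounded (L g) := lin_bounded_generator bg.

(** The squared l^2(mu) norm of L g, which measures the energy lost in one step. *)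
Definition energy_rate : R := rsum (fun x => dens x * (L g x * L g x)).

Lemma fisher_form_step : CD_Upsilon k p kappa ->
  (1 + 2 * kappa * h) * fisher_form g <= fisher_form f.
Proof.
move=> CD; have := fisher_form_convex fr gr; apply: le_trans.
rewrite (eq_rsum (g := fun x => h * (dens x * ((L (phi \o g) x +
    g x `^ (p - 1 - 1) * L g x) * L g x)))); last first.
  by move=> x; rewrite fE; ring.
have bphi := sup_bounded_dPhi gr.
rewrite rsumZ; last first.
  apply: abs_summable_densM ls; apply: lin_boundedD (lin_bounded_generator bphi) _.
  exact: lin_boundedM (sup_bounded_powR _ gr) ls.
have := ler_wpM2l (ltW h_gt0) (CD_fisher_form CD gr).
by move: (fisher_form g) (rsum _) => a b; lra.
Qed.

(** The quadratic bound is applied to f = g - h L g around g; the linear term is h times the Fisher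
    information by integration by parts. *)
Lemma mean_entropy_step : mean_entropy f <= mean_entropy g + h * fisher_form g +
  m `^ (p - 1 - 1) * h ^+ 2 * energy_rate.
Proof.
have bphi := sup_bounded_dPhi gr; have [m0 _] := gr.
have s1 := abs_summable_mul_dens (sup_bounded_Phi gr).
have s2 := abs_summable_generator bphi lg.
have s3 := abs_summable_densM ls ls.
have EF : rsum (fun x => dens x * ((phi \o g) x * L g x)) = - fisher_form g.
  by rewrite rsum_generator// dirichletC mulNr.
rewrite /mean_entropy /energy_rate.
have -> : h * fisher_form g = - h * rsum (fun x => dens x * ((phi \o g) x * L g x)).
  by rewrite EF mulrNN.
rewrite -rsumZ// -rsumZ// -rsumD//; last exact: abs_summableZ.
rewrite -rsumD; [|by apply: abs_summableD => //; exact: abs_summableZ|exact: abs_summableZ].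
apply: ler_rsum.
- exact/abs_summable_mul_dens/(sup_bounded_Phi fr).
- apply: abs_summableD; last exact: abs_summableZ.
  by apply: abs_summableD => //; exact: abs_summableZ.
move=> x; have /andP[mf _] := fr.2 x; have /andP[mg _] := gr.2 x.
have := ler_wpM2r (ltW (dens_gt0 x)) (Phi_le_quadratic p_gt1 p_lt2 m0 mf mg).
move=> H; apply: le_trans H _.
by rewrite fE /= le_eqVlt; apply/orP; left; apply/eqP; ring.
Qed.

(** Expanding the square around g and dropping the energy of f - g leaves twice the cross term,
    which f - g = - h L g turns into 4 h |L g|^2. *)
Lemma dirichlet_step : dirichlet g g + 4 * h * energy_rate <= dirichlet f f.
Proof.
have bf := sup_bounded_range fr; have lf := sup_bounded_lin bf.
have bw := sup_boundedB bf bg.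
have sg := abs_summable_dirichlet bg lg.
have sf := abs_summable_dirichlet bf lf.
have sw := abs_summable_dirichlet bw lg.
have <- : 2 * dirichlet (fun x => f x - g x) g = 4 * h * energy_rate.
  have := rsum_generator bw lg.
  rewrite (eq_rsum (g := fun x => - h * (dens x * (L g x * L g x)))); last first.
    by move=> x; rewrite fE; ring.
  rewrite rsumZ -/energy_rate; last exact: abs_summable_densM.
  by move: (dirichlet _ _) energy_rate => a b; lra.
rewrite /dirichlet -rsumZ// -rsumD//; last exact: abs_summableZ.
apply: ler_rsum => //; first by apply: abs_summableD => //; exact: abs_summableZ.
move=> [x y] /=; rewrite -subr_ge0.
have -> : forall a b c e t : R, t * ((a - b) * (a - b)) -
  (t * ((c - e) * (c - e)) + 2 * (t * ((a - c - (b - e)) * (c - e)))) =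
  t * (a - c - (b - e)) ^+ 2 by move=> a b c e t; ring.
by rewrite mulr_ge0 ?flow_ge0// sqr_ge0.
Qed.

(** Mass is conserved: L g integrates to 0, being paired with a constant. *)
Lemma rsum_dens_step : rsum (fun x => dens x * f x) = rsum (fun x => dens x * g x).
Proof.
have b1 : sup_bounded (fun _ => 1) by exists 1 => ?; rewrite normr1.
have s1 := abs_summable_dens1 lg; have s2 := abs_summable_generator b1 lg.
have E0 : rsum (fun x => dens x * (1 * L g x)) = 0.
  rewrite rsum_generator// /dirichlet (eq_rsum (g := fun=> 0)) ?rsum0 ?mulr0//.
  by move=> z; rewrite subrr mul0r mulr0.
rewrite (eq_rsum (g := fun x => dens x * g x - h * (dens x * (1 * L g x)))).
  by rewrite rsumB ?rsumZ// ?E0 ?mulr0 ?subr0//; exact: abs_summableZ.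
by move=> x; rewrite fE; ring.
Qed.

(** The last coefficient is chosen so that the energy gain 4 h |L g|^2 cancels the quadratic error
    m^(p-2) h^2 |L g|^2 of the entropy estimate. *)
Definition lyapunov u : R := mean_entropy u - fisher_form u / (2 * kappa) -
  m `^ (p - 1 - 1) * h / 4 * dirichlet u u.

(** Divided by 2 kappa, the decay of the Fisher information supplies exactly the term h I(g) by
    which the entropy may drop. *)
Lemma lyapunov_step : CD_Upsilon k p kappa -> 0 < kappa ->
  lyapunov f <= lyapunov g.
Proof.
move=> CD kap0; have F := fisher_form_step CD.
have H := mean_entropy_step; have [m0 _] := gr.
have c0 : 0 <= m `^ (p - 1 - 1) * h / 4.
  by rewrite divr_ge0// mulr_ge0 ?powR_ge0// ltW.
have D := ler_wpM2l c0 dirichlet_step.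
have i0 : 0 <= (2 * kappa)^-1 by rewrite invr_ge0 mulr_ge0// ltW.
have {}F := ler_wpM2r i0 F.
have E : (1 + 2 * kappa * h) * fisher_form g / (2 * kappa) =
    fisher_form g / (2 * kappa) + h * fisher_form g.
  by field; rewrite gt_eqF.
move: F H D; rewrite E /lyapunov.
move: (m `^ _) (mean_entropy f) (mean_entropy g) (dirichlet f f) (dirichlet g g).
move: (fisher_form f) (fisher_form g) energy_rate => F1 F2 N c H1 H2 D1 D2.
by clear c0; lra.
Qed.

End ImplicitEulerStep.

(** * Convergence of the scheme *)

Lemma dPhi_dirichlet_ge m M g z : in_range m M g ->
  M `^ (p - 1 - 1) * (flow z * (g z.2 - g z.1) ^+ 2) <=
  flow z * ((g z.2 - g z.1) * ((phi \o g) z.2 - (phi \o g) z.1)).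
Proof.
move=> gr; have pos x : 0 < g x <= M.
  by rewrite (in_range_gt0 x gr); have /andP[] := gr.2 x.
by rewrite mulrCA ler_wpM2l ?flow_ge0//; exact: dPhi_increment_ge.
Qed.

Lemma dPhi_dirichlet_ge0 m M g z : in_range m M g ->
  0 <= flow z * ((g z.2 - g z.1) * ((phi \o g) z.2 - (phi \o g) z.1)).
Proof.
move=> gr; apply: le_trans (dPhi_dirichlet_ge z gr).
by rewrite mulr_ge0 ?powR_ge0// mulr_ge0 ?flow_ge0// sqr_ge0.
Qed.

Lemma fisher_form_ge0 m M g : in_range m M g -> 0 <= fisher_form g.
Proof.
move=> gr; rewrite mulr_ge0 ?invr_ge0//; apply: rsum_ge0 => z.
exact: dPhi_dirichlet_ge0 gr.
Qed.

Lemma flow_sq_le_fisher_form m M g z : in_range m M g ->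
  M `^ (p - 1 - 1) * (flow z * (g z.2 - g z.1) ^+ 2) <= 2 * fisher_form g.
Proof.
move=> gr; apply: le_trans (dPhi_dirichlet_ge z gr) _.
rewrite /fisher_form mulVKf ?pnatr_eq0//.
apply: (rsum_ge_term _ (fun z => dPhi_dirichlet_ge0 z gr)).
apply: abs_summable_dirichlet (sup_bounded_range gr) _.
exact/sup_bounded_lin/(sup_bounded_dPhi gr).
Qed.

Lemma range_bounds m M g (x : X) : in_range m M g -> 0 < m <= M.
Proof. by move=> [-> /(_ x)/andP[]]; exact: le_trans. Qed.

(** Induction along a path of positive rates: on each edge the squared increment is at most a
    constant times the Fisher information. *)
Lemma increments_cvg0 m M (g : nat -> X -> R) x y : irreducible k ->
  (forall n, in_range m M (g n)) -> fisher_form (g n) @[n --> \oo] --> 0 ->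
  (g n y - g n x) ^+ 2 @[n --> \oo] --> 0.
Proof.
move=> irr gr F0; have [s [_ ps <-]] := irr x y.
elim: s x ps => [|z s IH] x /=.
  by move=> _; under eq_fun do rewrite subrr expr0n; exact: cvg_cst.
move=> /andP[kxz /IH{}IH].
have xz : x != z.
  by apply: contraTneq kxz => <-; rewrite -leNgt ltW//; case: (k_rates.2 x).
have /andP[m0 mM] := range_bounds x (gr 0%N).
pose c := M `^ (p - 1 - 1) * flow (x, z).
have c0 : 0 < c.
  rewrite mulr_gt0 ?powR_gt0//; first exact: lt_le_trans mM.
  by rewrite /flow /= (negbTE xz) mulr_gt0.
(* The factors 2 come from (a + b)^2 <= 2 a^2 + 2 b^2, splitting off the first edge. *)
have C0 : 2 * (2 / c * fisher_form (g n)) + 2 * (g n (last z s) - g n z) ^+ 2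
    @[n --> \oo] --> 0.
  rewrite -[X in _ --> X](addr0 0); apply: cvgD.
    rewrite -[X in _ --> X](mulr0 2); apply: cvgMl_tmp.
    by rewrite -[X in _ --> X](mulr0 (2 / c)); exact: cvgMl_tmp.
  by rewrite -[X in _ --> X](mulr0 2); exact: cvgMl_tmp.
apply: (squeeze_cvgr _ (cvg_cst 0) C0); apply: nearW => n.
rewrite sqr_ge0/=.
have : (g n z - g n x) ^+ 2 <= 2 / c * fisher_form (g n).
  have := flow_sq_le_fisher_form (x, z) (gr n); rewrite mulrA -/c.
  by rewrite -ler_pdivlMl// mulrA [_^-1 * 2]mulrC.
have : 0 <= ((g n (last z s) - g n z) - (g n z - g n x)) ^+ 2 by exact: sqr_ge0.
by move: (g n (last z s)) (g n z) (g n x) (2 / c * _) => a b e t; lra.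
Qed.

(** The mean minimizes the squared deviation, so convergence of increments from one fixed point x
    controls the variance. *)
Lemma variance_le m M g x : in_range m M g ->
  rsum (fun y => dens y * (g y - rsum (fun z => dens z * g z)) ^+ 2) <=
  rsum (fun y => dens y * (g y - g x) ^+ 2).
Proof.
move=> gr; set c := rsum (fun z => dens z * g z).
have bg := sup_bounded_range gr.
have b r : sup_bounded (fun=> r : R) by exists `|r|.
have bc := sup_boundedB bg (b c).
have s0 := abs_summable_dens1 (sup_bounded_lin bg).
have s1 : abs_summable (fun y => dens y * (g y - c) ^+ 2).
  exact/abs_summable_dens1/sup_bounded_lin/(sup_boundedM bc bc).
have s2 : abs_summable (fun y => dens y * (g y - c)).
  exact/abs_summable_dens1/sup_bounded_lin.
have E0 : rsum (fun y => dens y * (g y - c)) = 0.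
  rewrite (eq_rsum (g := fun y => dens y * g y - c * dens y)); last first.
    by move=> y; ring.
  have sd := abs_summable_dens.
  by rewrite rsumB ?rsumZ ?rsum_dens ?mulr1 ?subrr//; exact: abs_summableZ.
rewrite [leRHS](eq_rsum (g := fun y => dens y * (g y - c) ^+ 2 +
  (- (2 * (g x - c)) * (dens y * (g y - c)) + (g x - c) ^+ 2 * dens y))); last first.
  by move=> y; ring.
have sd := abs_summable_dens.
rewrite rsumD ?rsumD ?rsumZ// ?E0 ?rsum_dens.
- by rewrite mulr0 add0r mulr1 lerDl sqr_ge0.
- exact: abs_summableZ.
- exact: abs_summableZ.
- by apply: abs_summableD; exact: abs_summableZ.
Qed.

Lemma mean_in_range m M g : in_range m M g ->
  m <= rsum (fun x => dens x * g x).
Proof.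
move=> gr; have sd := abs_summable_dens.
have := @ler_rsum _ _ (fun x => m * dens x) (fun x => dens x * g x).
rewrite rsumZ// rsum_dens mulr1; apply.
- exact: abs_summableZ.
- exact/abs_summable_dens1/sup_bounded_lin/sup_bounded_range/gr.
- by move=> x; rewrite mulrC ler_pM2l//; have /andP[] := gr.2 x.
Qed.

(** The quadratic bound around the mean c, whose linear term integrates to 0. *)
Lemma mean_entropy_le_variance m M g : in_range m M g ->
  mean_entropy g <= Phi p (rsum (fun x => dens x * g x)) + m `^ (p - 1 - 1) *
    rsum (fun y => dens y * (g y - rsum (fun x => dens x * g x)) ^+ 2).
Proof.
move=> gr; set c := rsum (fun z => dens z * g z).
have [m0 _] := gr; have mc : m <= c by exact: mean_in_range gr.
have bg := sup_bounded_range gr.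
have b r : sup_bounded (fun=> r : R) by exists `|r|.
have bc := sup_boundedB bg (b c).
have sd := abs_summable_dens.
have s0 := abs_summable_dens1 (sup_bounded_lin bg).
have s1 : abs_summable (fun y => dens y * (g y - c) ^+ 2).
  exact/abs_summable_dens1/sup_bounded_lin/(sup_boundedM bc bc).
have sD := abs_summableZ (Phi p c - phi c * c) sd.
have sG := abs_summableZ (phi c) s0.
have s2 := abs_summableD sD sG.
have s3 := abs_summableZ (m `^ (p - 1 - 1)) s1.
have -> : Phi p c = rsum (fun y => (Phi p c - phi c * c) * dens y + phi c * (dens y * g y)).
  by rewrite rsumD// !rsumZ// rsum_dens -/c mulr1 subrK.
rewrite -rsumZ// -rsumD//; apply: ler_rsum.
- exact/abs_summable_mul_dens/(sup_bounded_Phi gr).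
- exact: abs_summableD.
move=> y; have /andP[mg _] := gr.2 y.
have := ler_wpM2r (ltW (dens_gt0 y)) (Phi_le_quadratic p_gt1 p_lt2 m0 mg mc).
by move=> H; apply: le_trans H _; rewrite le_eqVlt; apply/orP; left; apply/eqP; ring.
Qed.

(** Only the quantities inherited from f are recorded, so functions chosen for different n need not
    belong to one orbit of the scheme. *)
Lemma implicit_euler_iterates m M h f : CD_Upsilon k p kappa -> 0 < kappa ->
  in_range m M f -> 0 < h -> forall n, exists g,
  [/\ in_range m M g,
      rsum (fun x => dens x * g x) = rsum (fun x => dens x * f x),
      (1 + 2 * kappa * h) ^+ n * fisher_form g <= fisher_form f &
      lyapunov m h f <= lyapunov m h g].
Proof.
move=> CD kap0 fr h0; elim=> [|n [g [gr Em Fg Vg]]].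
  by exists f; split; rewrite ?expr0 ?mul1r.
have [g' gr' gE] := resolvent_exists gr h0.
exists g'; split; first exact: gr'.
- by rewrite -Em (rsum_dens_step gr' gE).
- apply: le_trans Fg; rewrite exprSr -mulrA ler_wpM2l//.
    by rewrite exprn_ge0// addr_ge0// !mulr_ge0// ltW.
  exact: (fisher_form_step gr gr' h0 gE CD).
- exact: le_trans Vg (lyapunov_step gr gr' h0 gE CD kap0).
Qed.

(** The functional grows along the scheme and is at most the entropy, which is at most Phi(c) plus a
    multiple of the variance; the variance becomes arbitrarily small. *)
Lemma lyapunov_le m M h f (x : X) : irreducible k ->
  CD_Upsilon k p kappa -> 0 < kappa -> in_range m M f -> 0 < h ->
  lyapunov m h f <= Phi p (rsum (fun x => dens x * f x)).
Proof.
move=> irr CD kap0 fr h0.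
have [g gP] := choice (implicit_euler_iterates CD kap0 fr h0).
have gr n : in_range m M (g n) by case: (gP n).
have F0 : fisher_form (g n) @[n --> \oo] --> 0.
  pose r := (1 + 2 * kappa * h)^-1.
  have b1 : 1 < 1 + 2 * kappa * h by rewrite ltrDl !mulr_gt0.
  have r1 : `|r| < 1.
    by rewrite ger0_norm ?invr_ge0 ?invf_lt1// ?(lt_trans ltr01)// ltW// (lt_trans ltr01).
  have C0 : fisher_form f * r ^+ n @[n --> \oo] --> 0.
    by rewrite -[X in _ --> X](mulr0 (fisher_form f)); apply: cvgMl_tmp; exact: cvg_expr.
  apply: (squeeze_cvgr _ (cvg_cst 0) C0); apply: nearW => n.
  rewrite (fisher_form_ge0 (gr n))/= /r exprVn ler_pdivlMr.
    by rewrite mulrC; case: (gP n).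
  by rewrite exprn_gt0// (lt_trans ltr01).
have /andP[m0 mM] := range_bounds x fr.
set c := rsum _; apply/ler_addgt0Pr => e e0.
have C0 : 0 < m `^ (p - 1 - 1) by exact: powR_gt0.
(* Two values in [m, M] differ by at most M. The tolerance anticipates the factor m^(p-2) in front
   of the variance. *)
have [|||n hn] := @rsum_bounded_cvg0 _ _ dens (fun n y => (g n y - g n x) ^+ 2)
  (M ^+ 2) (fun y => ltW (dens_gt0 y)) abs_summable_dens _ _ (e / m `^ (p - 1 - 1)).
- move=> n y; rewrite sqr_ge0/= -real_normK ?num_real// ler_pXn2r ?nnegrE//; last first.
    by rewrite ltW// (lt_le_trans m0).
  have /andP[a1 a2] := (gr n).2 x; have /andP[a3 a4] := (gr n).2 y.
  by rewrite ler_norml; move: (g n x) (g n y) a1 a2 a3 a4 => a b; lra.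
- move=> y d d0; have /cvgrPdist_le/(_ d d0) [N _ hN] := increments_cvg0 x y irr gr F0.
  by exists N => i Ni; have := hN i Ni; rewrite sub0r normrN ger0_norm// sqr_ge0.
- by rewrite divr_gt0.
have [_ Em _ V] := gP n; apply: le_trans V _.
have := mean_entropy_le_variance (gr n); rewrite Em -/c => H.
have Va := variance_le x (gr n); rewrite Em -/c in Va.
have := ler_wpM2l (ltW C0) (le_trans Va hn); rewrite /= [_ * (e / _)]mulrC divfK ?gt_eqF// => W.
have F : 0 <= fisher_form (g n) / (2 * kappa).
  by rewrite divr_ge0 ?(fisher_form_ge0 (gr n))// mulr_ge0// ltW.
have D : 0 <= m `^ (p - 1 - 1) * h / 4 * dirichlet (g n) (g n).
  rewrite mulr_ge0//; first by rewrite divr_ge0// mulr_ge0// ltW.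
  by apply: rsum_ge0 => z; rewrite mulr_ge0 ?flow_ge0// -expr2 sqr_ge0.
rewrite /lyapunov; move: H W F D.
move: (mean_entropy _) (fisher_form _ / _) (_ * dirichlet _ _) => a b d.
move: (m `^ _ * _) (Phi p c) => *; lra.
Qed.

Lemma Beckner_range m M f (x : X) : irreducible k ->
  CD_Upsilon k p kappa -> 0 < kappa -> in_range m M f ->
  mean_entropy f <=
    Phi p (rsum (fun x => dens x * f x)) + fisher_form f / (2 * kappa).
Proof.
move=> irr CD kap0 fr; apply/ler_addgt0Pr => e e0.
have D0 : 0 <= dirichlet f f.
  by apply: rsum_ge0 => z; rewrite mulr_ge0 ?flow_ge0// -expr2 sqr_ge0.
have C0 : 0 < m `^ (p - 1 - 1) by apply: powR_gt0; exact: fr.1.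
(* With this h the energy correction equals e D / (1 + D) <= e, where D is the energy of f; adding 1
   covers D = 0. *)
pose h := 4 * e / (m `^ (p - 1 - 1) * (1 + dirichlet f f)).
have D1 : 0 < 1 + dirichlet f f by rewrite ltr_wpDr.
have h0 : 0 < h by rewrite divr_gt0// mulr_gt0.
have := lyapunov_le x irr CD kap0 fr h0; rewrite /lyapunov.
have : m `^ (p - 1 - 1) * h / 4 * dirichlet f f <= e.
  have -> : m `^ (p - 1 - 1) * h / 4 * dirichlet f f =
      e * (dirichlet f f / (1 + dirichlet f f)).
    by rewrite /h; field; rewrite !gt_eqF.
  by rewrite ger_pMr// ler_pdivrMr// mul1r lerDr.
move: (mean_entropy _) (fisher_form _ / _) (_ * dirichlet _ _) (Phi p _) => *; lra.
Qed.

(** * Truncation of unbounded densities *)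

Lemma fisher_termE f z : (forall x, 0 < f x) ->
  k z.1 z.2 * (f z.2 - f z.1) *
    (derive1 (Phi p) (f z.2) - derive1 (Phi p) (f z.1)) * dens z.1 =
  flow z * ((f z.2 - f z.1) * ((phi \o f) z.2 - (phi \o f) z.1)).
Proof.
move=> f0; rewrite !derive1_Phi// /flow; case: eqVneq => [->|_] /=; last by ring.
by rewrite !subrr !(mulr0, mul0r).
Qed.

Lemma fisher_term_ge0 f z : (forall x, 0 < f x) ->
  0 <= flow z * ((f z.2 - f z.1) * ((phi \o f) z.2 - (phi \o f) z.1)).
Proof.
move=> f0; rewrite mulr_ge0 ?flow_ge0//.
have [le|/ltW le] := leP (f z.1) (f z.2).
  by rewrite mulr_ge0 ?subr_ge0// dPhi_le// ltW.
by rewrite mulr_le0 ?subr_le0// dPhi_le// ltW.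
Qed.

(** For the truncation with mean c, the linear part -c of the entropy cancels against that of
    Phi(c), leaving a bound on the p-th power sum by c^p with c <= 1 + m. *)
Lemma power_sum_clamp_le m M f (x : X) : irreducible k ->
  CD_Upsilon k p kappa -> 0 < kappa -> prob_density dens f ->
  abs_summable (fun z =>
    flow z * ((f z.2 - f z.1) * ((phi \o f) z.2 - (phi \o f) z.1))) ->
  0 < m <= 1 -> m <= M ->
  rsum (fun x => clamp m M (f x) `^ p * dens x) <=
    1 + p * (p - 1) * (fisher_form f / (2 * kappa)) + 3 * m.
Proof.
move=> irr CD kap0 [f0 f1] sF /andP[m0 m1] mM.
pose g y := clamp m M (f y).
have gr : in_range m M g by split=> // y; exact: clamp_range.
have bg := sup_bounded_range gr.
have pp0 : 0 < p * (p - 1) by rewrite mulr_gt0 ?subr_gt0// (lt_trans ltr01).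
have B := Beckner_range x irr CD kap0 gr; set c := rsum _ in B.
have Fgf : fisher_form g <= fisher_form f.
  apply: ler_wpM2l; first by rewrite invr_ge0.
  apply: ler_rsum; [|exact: sF|move=> z; rewrite ler_wpM2l ?flow_ge0//].
    apply: abs_summable_dirichlet bg _.
    exact/sup_bounded_lin/(sup_bounded_dPhi gr).
  by apply: clamp_increment_le => //; rewrite m0.
have sf : abs_summable (fun y => dens y * f y).
  apply: ge0_abs_summable => [y|]; first by rewrite mulr_ge0// ltW.
  rewrite (eq_esum (b := fun y => (f y * dens y)%:E)) ?f1 ?ltry// => y _.
  by rewrite mulrC.
have Ef : rsum (fun y => dens y * f y) = 1.
  rewrite rsumE => [|y]; last by rewrite mulr_ge0// ltW.
  rewrite (eq_esum (b := fun y => (f y * dens y)%:E)) ?f1// => y _.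
  by rewrite mulrC.
have sd := abs_summable_dens.
have sg := abs_summable_dens1 (sup_bounded_lin bg).
have c1 : c <= 1 + m.
  rewrite -Ef -[X in _ + X]mulr1 -rsum_dens -rsumZ// -rsumD//; last exact: abs_summableZ.
  apply: ler_rsum => //; first by apply: abs_summableD => //; exact: abs_summableZ.
  by move=> y; rewrite -(mulrC (dens y)) -mulrDr ler_pM2l// clamp_leD.
have c0 : 0 < c by apply: lt_le_trans (mean_in_range gr).
(* As p < 2 and m <= 1, c^p <= (1 + m)^2 <= 1 + 3 m. *)
have cp : c `^ p <= 1 + 3 * m.
  apply: (@le_trans _ _ ((1 + m) `^ p)).
    apply: ge0_ler_powR => //; rewrite ?nnegrE; last by rewrite addr_ge0// ltW.
      exact/ltW/(lt_trans ltr01).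
    exact: ltW.
  apply: (@le_trans _ _ ((1 + m) `^ 2)).
    by rewrite ler_powR ?lerDl ?ltW.
  rewrite powR_mulrn; last by rewrite addr_ge0// ltW.
  have mm : m * m <= m by rewrite ger_pMl.
  have -> : (1 + m) ^+ 2 = 1 + 2 * m + m * m by ring.
  by clear B c1; lra.
have sp := abs_summable_mul_dens (sup_bounded_powR p gr).
have EH : mean_entropy g = (p * (p - 1))^-1 * (rsum (fun y => g y `^ p * dens y) - c).
  rewrite -rsumB// -rsumZ; last exact: abs_summableB.
  by apply: eq_rsum => y; rewrite /Phi; ring.
have := ler_wpM2l (ltW pp0) B; rewrite EH mulVKf ?gt_eqF// mulrDr.
rewrite {1}/Phi [_ / (p * (p - 1))]mulrC mulVKf ?gt_eqF//.
have Fk : p * (p - 1) * (fisher_form g / (2 * kappa)) <=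
    p * (p - 1) * (fisher_form f / (2 * kappa)).
  by rewrite ler_pM2l// ler_pM2r// invr_gt0 mulr_gt0.
move: Fk cp; rewrite -/(g _).
move: (_ * (fisher_form g / _)) (_ * (fisher_form f / _)) (c `^ p) (rsum _) => *.
lra.
Qed.

(** It suffices to bound finite partial sums. Taking M above f on the finite set makes the
    truncation dominate f there, and m <= e / 3 absorbs the error 3 m. *)
Lemma power_esum_le f (x : X) : irreducible k ->
  CD_Upsilon k p kappa -> 0 < kappa -> prob_density dens f ->
  abs_summable (fun z =>
    flow z * ((f z.2 - f z.1) * ((phi \o f) z.2 - (phi \o f) z.1))) ->
  (\esum_(x in [set: X]) (f x `^ p * dens x)%:E <=
    (1 + p * (p - 1) * (fisher_form f / (2 * kappa)))%:E)%E.
Proof.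
move=> irr CD kap0 fP sF; have [f0 f1] := fP.
apply: ge_ereal_sup => _ [A [finA _] <-].
apply/lee_addgt0Pr => e e0; rewrite -EFinD.
pose m := Num.min (e / 3) 1.
have m0 : 0 < m by rewrite lt_min divr_gt0/=.
have me : 3 * m <= e by rewrite mulrC -ler_pdivlMr// ge_min lexx.
have m1 : m <= 1 by rewrite ge_min lexx orbT.
have [s As] := (finite_seqP A).1 finA.
pose M := \big[Num.max/m]_(y <- s) f y.
have mM : m <= M.
  by rewrite /M; elim: (s) => [|y s' IH]; rewrite ?big_nil// big_cons le_max IH orbT.
have fM y : y \in s -> f y <= M.
  rewrite /M; elim: (s) => // z s' IH; rewrite inE big_cons le_max.
  by move=> /predU1P[->|/IH ->]; rewrite ?lexx ?orbT.
have := power_sum_clamp_le x irr CD kap0 fP sF _ mM.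
rewrite m0 => /(_ m1) H.
apply: (@le_trans _ _ (rsum (fun y => clamp m M (f y) `^ p * dens y))%:E); last first.
  by rewrite lee_fin (le_trans H)// lerD2l.
have gr : in_range m M (fun y => clamp m M (f y)) by split=> // y; exact: clamp_range.
rewrite EFin_rsum; last 2 first.
- by move=> y; rewrite mulr_ge0 ?powR_ge0// ltW.
- exact/abs_summable_mul_dens/(sup_bounded_powR p gr).
apply: esum_ge; exists A; first by split.
apply: lee_fsum => // y Ay; rewrite lee_fin ler_pM2r// ge0_ler_powR ?nnegrE//.
- by rewrite ltW// (lt_trans ltr01).
- exact: ltW.
- by rewrite (le_trans (ltW m0))//; have /andP[] := gr.2 y.
- by apply/le_clamp/fM; move: Ay; rewrite As.
Qed.

(** Since f has mean 1, its entropy is the p-th power sum minus 1, divided by p (p - 1), so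
    [power_esum_le] is the claim in the case of finite Fisher information. *)
Lemma Beckner_of_CD : irreducible k -> CD_Upsilon k p kappa -> 0 < kappa ->
  Beckner k dens p kappa.
Proof.
move=> irr CD kap0 f fP _; have [f0 f1] := fP.
(* A base point exists because the weights sum to 1. *)
have [x _] : exists x : X, True.
  apply: contrapT => X0; have : (\esum_(x in [set: X]) (dens x)%:E = 0)%E.
    by apply: esum1 => x; have := X0 (ex_intro _ x I).
  by rewrite dens_sum1 => /eqP; rewrite onee_eq0.
rewrite /fisher (eq_esum (b := fun z => (flow z * ((f z.2 - f z.1) *
  ((phi \o f) z.2 - (phi \o f) z.1)))%:E)); last by move=> z _; rewrite fisher_termE.
have T0 z := fisher_term_ge0 z f0.
have kap1 : 0 < 1 / (2 * kappa) by rewrite divr_gt0// mulr_gt0.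
(* If the Fisher sum diverges, the right-hand side is infinite. *)
set S := esum _ _; have [Sfin|] := ltP S +oo%E; last first.
  by rewrite leye_eq => /eqP ->; rewrite !gt0_muley ?leey// lte_fin.
have sF := ge0_abs_summable T0 Sfin.
have -> : S = (dirichlet f (phi \o f))%:E by rewrite EFin_rsum.
rewrite -(EFinM 2^-1) -/(fisher_form f) -EFinM.
have pw := power_esum_le x irr CD kap0 fP sF.
have fp0 y : 0 <= f y `^ p * dens y by rewrite mulr_ge0 ?powR_ge0// ltW.
have sp : abs_summable (fun y => f y `^ p * dens y).
  by apply: ge0_abs_summable => //; apply: le_lt_trans pw _; rewrite ltry.
have sf : abs_summable (fun y => f y * dens y).
  apply: ge0_abs_summable => [y|]; first by rewrite mulr_ge0// ltW.
  by rewrite f1 ltry.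
have Ef : rsum (fun y => f y * dens y) = 1.
  by rewrite rsumE ?f1// => y; rewrite mulr_ge0// ltW.
have PhiE y : Phi p (f y) * dens y =
    (p * (p - 1))^-1 * (f y `^ p * dens y - f y * dens y).
  by rewrite /Phi; ring.
rewrite /entropy (funext PhiE) xsum_rsum; last exact/abs_summableZ/abs_summableB.
rewrite lee_fin rsumZ ?rsumB// ?Ef; last exact: abs_summableB.
move: pw; rewrite -EFin_rsum// lee_fin => pw.
have pp0 : 0 < p * (p - 1) by rewrite mulr_gt0 ?subr_gt0// (lt_trans ltr01).
by rewrite ler_pdivrMl// mul1r (mulrC (2 * kappa)^-1) lerBlDl.
Qed.

End ReversibleRates.

Theorem corollary6p9 (R : realType) (X : countType)
  (k : X -> X -> R) (dens : X -> R)
  (d : measure_display) (Omega : measurableType d)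
  (Pr : X -> probability Omega R) (Y : nat -> Omega -> X)
  (T : nat -> Omega -> R) (p kappa : R)
  (k_rates : transition_rates k)
  (chain : markov_chain k Pr Y T)
  (k_irr : irreducible k)
  (dens_inv : invariant_measure Pr Y T dens)
  (dens_uniq : forall nu : X -> R, invariant_measure Pr Y T nu ->
     exists2 c : R, 0 < c & forall x, nu x = c * dens x)
  (dens_gt0 : forall x, 0 < dens x)
  (dens_sum1 : \esum_(x in [set: X]) (dens x)%:E = 1%E)
  (k_db : detailed_balance k dens)
  (M1_fin : forall x, (M1 k x < +oo)%E)
  (M2_fin : forall x, (M2 k x < +oo)%E)
  (P_markov : markovian Pr Y T)
  (p_gt1 : 1 < p) (p_lt2 : p < 2) (kappa_gt0 : 0 < kappa)
  (k_CD : CD_Upsilon k p kappa)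
  (M1_l2 : in_lp dens 2 (fine \o M1 k))
  (M2_l1 : in_lp dens 1 (fine \o M2 k)) :
  Beckner k dens p kappa.
Proof. exact: Beckner_of_CD. Qed.
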